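(* Let $(a,b)\in\mathcal P'$. If $(\eta(x))_{x\in\mathbb Z}$ is a (stationary) two-sided homogeneous Markov chain on $\{0,1\}$ with transition matrix $P(a,b)$, conditioned on $\Omega_r$, then for any $k\in\mathbb N$, $(\Psi_k(\eta)(x))_{x\in\mathbb Z}$ is also a two-sided homogeneous Markov chain conditioned on $\Omega_r$, with transition matrix $P(a_k,b_k)$.
   Context: $\mathbb N=\{1,2,\dots\}$. **Parameters.** $\mathcal P'=\{(a,b)\in[0,1]^2:a>0,\ \sqrt a+\sqrt b<1\}$. For $a,b\ge0$ with $\sqrt a+\sqrt b<1$, with $D=\sqrt{(1-(a+b))^2-4ab}$, $$P(a,b)=\begin{pmatrix} p(0,0) & p(0,1) \\ {p(1,0)} & p(1,1) \end{pmatrix}=\begin{pmatrix} \frac{1-a+b+D}{2} & \frac{1+a-b-D}{2} \\ \frac{1+a-b+D}{2} & \frac{1-a+b-D}{2} \end{pmatrix},$$ where $p(r,s)=\mathbb P(\eta(1)=s\mid\eta(0)=r)$. Set $a_0=a$, $b_0=b$ and $a_k=\frac{a_{k-1}b_{k-1}}{(1-a_{k-1})^2}$, $b_k=\frac{b_{k-1}}{(1-a_{k-1})^2}$ for $k\ge1$. **Configurations.** $\Omega=\{\eta\in\{0,1\}^{\mathbb Z}:\lim_{x\to\infty}\frac1x\sum_{y=-x}^{0}\eta(y)<\frac12\}$. A site $x$ is a record of $\eta$ if $\sum_{y=z}^{x}(2\eta(y)-1)<0$ for all $z\le x$. $\Omega_r$ is the set of $\eta\in\Omega$ whose records are unbounded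 above and below and for which the site $0$ is a record. ''Conditioned on $\Omega_r$'' means that the law is that of the stationary two-sided chain conditioned on the event $\Omega_r$. **Skip map.** For $\eta\in\Omega_r$ let $(\mathcal W_k(\eta,\cdot))_{k\in\mathbb N}$, $\mathcal W_k(\eta,\cdot):\mathbb Z\to\{0,1\}$, be the unique functions vanishing at every record and satisfying $\mathcal W_k(\eta,x)=\mathcal W_k(\eta,x-1)+\eta^{\uparrow}_k(x)-\eta^{\downarrow}_k(x)$ for all $x\in\mathbb Z$, where $\eta^{\uparrow}_k(x)=\eta(x)(1-\mathcal W_k(\eta,x-1))\prod_{j=1}^{k-1}\mathcal W_j(\eta,x-1)$ and $\eta^{\downarrow}_k(x)=(1-\eta(x))\mathcal W_k(\eta,x-1)\prod_{j=1}^{k-1}(1-\mathcal W_j(\eta,x-1))$. Define $\xi_k(\eta,\cdot):\mathbb Z\to\mathbb Z$ by $\xi_k(\eta,0)=0$ and $\xi_k(\eta,x)-\xi_k(\eta,x-1)=1-\sum_{j=1}^{k}(\eta^\uparrow_j(x)+\eta^\downarrow_j(x))$, and $s_k(\eta,x)=\min\{y\in\mathbb Z:\xi_k(\eta,y)=x\}$. Then $\Psi_k(\eta)(x)=\eta(s_k(\eta,x))$. *)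

(* Defs.v *)
From HB Require Import structures.
From mathcomp Require Import all_boot all_order all_algebra.
From mathcomp Require Import all_classical all_reals all_analysis.
Set Implicit Arguments.
Unset Strict Implicit.
Unset Printing Implicit Defensive.
Import Order.TTheory GRing.Theory Num.Theory.
Import numFieldNormedType.Exports.
Local Open Scope classical_set_scope.
Local Open Scope ring_scope.

(** ** Parameters *)

Definition in_P' {R : realType} (a b : R) : Prop :=
  [/\ 0 <= a <= 1, 0 <= b <= 1, 0 < a & Num.sqrt a + Num.sqrt b < 1].

(* [trans_mx a b r s] is p(r, s); [true] stands for 1 and [false] for 0. *)
Definition trans_mx {R : realType} (a b : R) (r s : bool) : R :=
  let D := Num.sqrt ((1 - (a + b)) ^+ 2 - 4 * a * b) in
  match r, s with
  | false, false => (1 - a + b + D) / 2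
  | false, true => (1 + a - b - D) / 2
  | true, false => (1 + a - b + D) / 2
  | true, true => (1 - a + b - D) / 2
  end.

Fixpoint ab_seq {R : realType} (a b : R) (k : nat) : R * R :=
  if k is k'.+1 then
    let: (a', b') := ab_seq a b k' in
    (a' * b' / (1 - a') ^+ 2, b' / (1 - a') ^+ 2)
  else (a, b).

Definition a_seq {R : realType} (a b : R) (k : nat) : R := (ab_seq a b k).1.
Definition b_seq {R : realType} (a b : R) (k : nat) : R := (ab_seq a b k).2.

(** ** Configurations *)

Definition config_cylinders : set (set (int -> bool)) :=
  [set A | exists (x : int) (s : bool), A = [set eta | eta x = s]].

(* {0,1}^Z with its product sigma-algebra. *)
Definition config := g_sigma_algebraType config_cylinders.

Definition left_density (R : realType) (eta : config) : R^nat :=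
  fun n => n%:R^-1 * \sum_(0 <= i < n.+1) (eta (- i%:Z) : nat)%:R.

Definition Omega (R : realType) : set config :=
  [set eta | exists2 l : R, left_density R eta @ \oo --> l & l < 1 / 2].

Definition sum_between (f : int -> int) (z x : int) : int :=
  \sum_(0 <= i < `|x - z|%N.+1) f (z + i%:Z).

Definition record (eta : config) (x : int) : Prop :=
  forall z : int, z <= x -> sum_between (fun y => 2 * (eta y : int) - 1) z x < 0.

Definition Omega_r (R : realType) : set config :=
  [set eta | [/\ Omega R eta,
    forall m : int, exists2 x, m < x & record eta x,
    forall m : int, exists2 x, x < m & record eta x
    & record eta 0]].

(** ** Skip map *)

(* Carrier functions are numbered from 1; the component [W 0] plays no role. *)
Definition arrow_up (eta : config) (W : nat -> int -> bool) (k : nat) (x : int)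
    : int :=
  (eta x : int) * (1 - (W k (x - 1) : int)) *
  \prod_(1 <= j < k) (W j (x - 1) : int).

Definition arrow_down (eta : config) (W : nat -> int -> bool) (k : nat)
    (x : int) : int :=
  (1 - (eta x : int)) * (W k (x - 1) : int) *
  \prod_(1 <= j < k) (1 - (W j (x - 1) : int)).

Definition is_carrier (eta : config) (W : nat -> int -> bool) : Prop :=
  forall k : nat, (0 < k)%N ->
    (forall x, record eta x -> W k x = false) /\
    (forall x, (W k x : int) =
               (W k (x - 1) : int) + arrow_up eta W k x - arrow_down eta W k x).

Definition carrier (eta : config) : nat -> int -> bool :=
  xget (fun _ _ => false) [set W | is_carrier eta W].

Definition is_xi (eta : config) (k : nat) (xi : int -> int) : Prop :=
  xi 0 = 0 /\
  forall x, xi x - xi (x - 1) =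
    1 - \sum_(1 <= j < k.+1)
          (arrow_up eta (carrier eta) j x + arrow_down eta (carrier eta) j x).

Definition xi (k : nat) (eta : config) : int -> int :=
  xget (fun _ => 0) [set f | is_xi eta k f].

Definition skip_site (k : nat) (eta : config) (x : int) : int :=
  xget 0 [set y | xi k eta y = x /\ forall z, xi k eta z = x -> y <= z].

(* Only the values on [Omega_r] are meaningful.  The explicit value outside of
   [Omega_r] keeps [Psi R k] measurable: there the choices made by [xget] need
   not depend measurably on the configuration. *)
Definition Psi (R : realType) (k : nat) (eta : config) : config :=
  if pselect (Omega_r R eta) then fun x => eta (skip_site k eta x) else eta.

(** ** Markov chains *)

Definition stationary (R : realType) (nu : probability config R) : Prop :=
  forall A : set config, measurable A ->
    nu [set eta | A (fun x => eta (x + 1))] = nu A.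

(* The Markov property at time [x], with respect to the last n.+1 states. *)
Definition markov_chain (R : realType) (p : bool -> bool -> R)
    (nu : probability config R) : Prop :=
  forall (x : int) (n : nat) (v : int -> bool) (s : bool),
    let past := [set eta : config |
      forall i : nat, (i <= n)%N -> eta (x - i%:Z) = v (x - i%:Z)] in
    nu (past `&` [set eta | eta (x + 1) = s]) = (nu past * (p (v x) s)%:E)%E.

(* The random configuration [X] has the law of the stationary two-sided chain
   with transition matrix [p], conditioned on the event [E]. *)
Definition conditioned_chain (R : realType) (d : measure_display)
    (T : measurableType d) (Pr : probability T R) (X : T -> config)
    (p : bool -> bool -> R) (E : set config) : Prop :=
  measurable_fun setT X /\
  exists nu : probability config R,
    [/\ stationary nu, markov_chain p nu, (0 < nu E)%E &
      forall A : set config, measurable A ->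
        Pr (X @^-1` A) = (fine (nu (A `&` E)) / fine (nu E))%:E].

(* Main.v *)
(** Write eta^(0) = eta and let eta^(k+1) be eta^(k) with the first letter of
    each run removed.  The letter W_(k+1)(x) turns out to be the letter of the
    last site weakly left of x that survives k such removals, and a site moves
    under xi_k exactly when it survives k removals; hence Psi_k is the k-th
    iterate of Psi_1, the removal map ([thin] below).  Removed letters
    alternate, so heights before and after a removal differ by a telescoping
    boundary term, and records correspond to records.

    For a chain nu with transition probabilities p, put a = p(0,1) p(1,0).
    Between two consecutive survivors the chain alternates, and summing the
    geometric series over the length of this alternation shows that the
    survivors form a chain with p'(r,r) = p(r,r) / (1 - a) and
    p'(r,s) = p(r,s) p(s,s) / (1 - a), which is P(a_1, b_1).  The Palm law nu'
    of the survivors is stationary, and up to null sets a configuration is in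
    Omega_r if and only if the origin survives and the thinned configuration
    is in Omega_r; so the law of Psi_1 under nu(. | Omega_r) is
    nu'(. | Omega_r).  The null sets come from the law of large numbers for
    the letters of two-state chains (variance bound, squares, Borel-Cantelli),
    which gives density below 1/2 almost surely for both nu and nu'. *)
Require Import Defs.
From HB Require Import structures.
From mathcomp Require Import all_boot all_order all_algebra.
From mathcomp Require Import all_classical all_reals all_analysis.
From mathcomp Require Import zify ring lra.
Set Implicit Arguments.
Unset Strict Implicit.
Unset Printing Implicit Defensive.
Import Order.TTheory GRing.Theory Num.Theory.
Import numFieldNormedType.Exports.
Local Open Scope classical_set_scope.
Local Open Scope ring_scope.

(** * Thinning and records *)
(** The primitive of [f] that vanishes at 0: the two branches are offset so that the increment at
    every [x], of either sign, is [f x]. *)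
Definition isum (f : int -> int) (x : int) : int :=
  match x with
  | Posz n => \sum_(i < n) f (i%:Z + 1)
  | Negz n => - \sum_(i < n.+1) f (- i%:Z)
  end.

Lemma isum0 f : isum f 0 = 0.
Proof. by rewrite /isum /= big_ord0. Qed.

Lemma isum_step f x : isum f x = isum f (x - 1) + f x.
Proof.
case: x => [[|n]|n].
- by rewrite isum0 (_ : 0 - 1 = Negz 0) //= big_ord1 oppr0 addNr.
- have -> : n.+1%:Z - 1 = n%:Z by lia.
  by rewrite /= big_ord_recr /=; congr (_ + f _); lia.
- have -> : Negz n - 1 = Negz n.+1 by lia.
  rewrite /= [in RHS]big_ord_recr /= opprD -addrA [X in _ + X](_ : _ = 0) ?addr0 //.
  by rewrite [Negz n](_ : _ = - n.+1%:Z) ?addNr //; lia.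
Qed.

Lemma int_ind_ge (P : int -> Prop) z : P z ->
  (forall x : int, z < x -> P (x - 1) -> P x) -> forall x : int, z <= x -> P x.
Proof.
move=> Pz step x zx; have -> : x = z + `|x - z|%N%:Z by lia.
elim: `|x - z|%N => [|n IH]; first by rewrite addr0.
by apply: step; [lia | have -> : z + n.+1%:Z - 1 = z + n%:Z by lia].
Qed.

Lemma int_ind_le (P : int -> Prop) z : P z ->
  (forall x : int, x <= z -> P x -> P (x - 1)) -> forall x : int, x <= z -> P x.
Proof.
move=> Pz step x zx; have -> : x = z - `|x - z|%N%:Z by lia.
elim: `|x - z|%N => [|n IH]; first by rewrite subr0.
have -> : z - n.+1%:Z = z - n%:Z - 1 by lia.
apply: step => //.
lia.
Qed.

Lemma eq_increments (f g : int -> int) : f 0 = g 0 ->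
  (forall x, f x - f (x - 1) = g x - g (x - 1)) -> f =1 g.
Proof.
move=> fg0 fg x; case: (leP 0 x) => [|/ltW] h.
  by move: x h; apply: int_ind_ge => // x _; have := fg x; lia.
by move: x h; apply: int_ind_le => // x _; have := fg x; lia.
Qed.

(** * Walks with steps 0 and 1 *)

Definition unbounded_both (P : int -> Prop) :=
  (forall m, exists2 x, m < x & P x) /\ (forall m, exists2 x, x < m & P x).

(** Common abstraction of ranks and levels; the sites kept by removals are the jumps. *)
Definition lazy_walk (f : int -> int) :=
  forall x, f x = f (x - 1) \/ f x = f (x - 1) + 1.

Definition jump (f : int -> int) (x : int) : Prop := f x = f (x - 1) + 1.

Section LazyWalk.
Variables (f : int -> int) (lf : lazy_walk f).

Lemma lazy_walk_homo : {homo f : x y / x <= y}.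
Proof.
move=> x; apply: int_ind_ge => // y _ xy; have := lf y; lia.
Qed.

Lemma jump_lt x y : x < y -> jump f y -> f x < f y.
Proof.
rewrite /jump => xy jy; have : f x <= f (y - 1) by apply: lazy_walk_homo; lia.
lia.
Qed.

Lemma jump_inj x y : jump f x -> jump f y -> f x = f y -> x = y.
Proof.
move=> jx jy fxy; case: (ltgtP x y) => // xy.
  by have := jump_lt xy jy; lia.
by have := jump_lt xy jx; lia.
Qed.

(** Infinitely many jumps on both sides carry the walk to both infinities, and steps of size at most
    1 cannot skip [y]. *)
Lemma lazy_walk_onto : unbounded_both (jump f) ->
  forall y, exists2 x, f x = y & jump f x.
Proof.
move=> [ub lb] y.
have hi n : exists x, n%:Z <= f x - f 0.
  elim: n => [|n [x hx]]; first by exists 0; lia.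
  have [x' xx' jx'] := ub x; exists x'.
  by have := jump_lt xx' jx'; lia.
have lo n : exists x, n%:Z <= f 0 - f x.
  elim: n => [|n [x hx]]; first by exists 0; lia.
  have [x' xx' jx'] := lb x; exists (x' - 1).
  have := lazy_walk_homo (ltW xx'); rewrite /jump in jx'; lia.
have [x0 hx0] := lo `|f 0 - y|%N.+1.
have [x1 hx1] := hi `|f 0 - y|%N.+1.
have x01 : x0 <= x1.
  by case: (leP x0 x1) => // /ltW /lazy_walk_homo; lia.
(* Going up from [x0], where the walk is below [y], it either is still below [y] or has already
   jumped onto [y]; at [x1] only the latter is left. *)
suff : f x1 < y \/ exists2 u, f u = y & jump f u by case=> //; lia.
move: x1 x01 {hx1}; apply: int_ind_ge; first by left; lia.
move=> x _ [|]; last by right.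
move=> h; have := lf x; case: (ltP (f x) y); first by left.
by right; exists x; rewrite /jump; lia.
Qed.

End LazyWalk.

(** * Survivors and the removal map *)

Definition survives (z : config) (x : int) : bool := z x == z (x - 1).

(** The signed count of survivors between 0 and [x]: it numbers the survivors consecutively and
    gives number 0 to the last one weakly left of 0. *)
Definition rank (z : config) : int -> int := isum (fun x => survives z x : int).

(* On the sites where two consecutive letters agree, [thin] forgets all other
   sites and keeps the origin at the last such site weakly left of 0. *)
Definition thin (z : config) : config :=
  fun x => `[< exists y, [/\ survives z y, rank z y = x & z y] >].

Lemma rank0 z : rank z 0 = 0. Proof. exact: isum0. Qed.

Lemma rank_step z x : rank z x = rank z (x - 1) + (survives z x : int).
Proof. exact: isum_step. Qed.

Lemma rank_lazy z : lazy_walk (rank z).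
Proof. by move=> x; rewrite (rank_step z x); case: survives; [right|left]; lia. Qed.

Lemma rank_jump z x : jump (rank z) x <-> survives z x.
Proof. by rewrite /jump (rank_step z x); case: survives; split => //; lia. Qed.

(** Survivors have distinct ranks, so the existential in [thin] has a single candidate. *)
Lemma thin_rank z y : survives z y -> thin z (rank z y) = z y.
Proof.
move=> sy; rewrite /thin; case E : (z y); first by apply/asboolP; exists y.
apply/asboolP => -[y' [sy' ry' zy']].
have eyy : y' = y by apply: (jump_inj (@rank_lazy z)) => //; exact/rank_jump.
by rewrite eyy E in zy'.
Qed.

Lemma rank_onto z : unbounded_both (survives z) ->
  forall y, exists2 x, rank z x = y & survives z x.
Proof.
move=> [ub lb] y; have [|x rx /rank_jump jx] := @lazy_walk_onto _ (@rank_lazy z) _ y.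
  split=> m.
    by have [x mx /rank_jump jx] := ub m; exists x.
  by have [x mx /rank_jump jx] := lb m; exists x.
by exists x.
Qed.

(** * Heights and records *)

Definition height (z : config) : int -> int := isum (fun x => 2 * (z x : int) - 1).

Lemma height_step z x : height z x = height z (x - 1) + (2 * (z x : int) - 1).
Proof. exact: isum_step. Qed.

(* Consecutive removed letters alternate, so their total contribution to the
   height telescopes. *)
Lemma height_thin z x :
  height (thin z) (rank z x) = height z x - (z x : int) + (z 0 : int).
Proof.
move: x; apply: eq_increments => [|x]; first by rewrite rank0 /height !isum0; lia.
have := height_step z x; have := rank_step z x.
case sx : (survives z x) => rx hx.
  have := height_step (thin z) (rank z x); rewrite thin_rank // {2}rx.
  have -> : rank z (x - 1) + true - 1 = rank z (x - 1) by lia.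
  by move: sx; rewrite /survives => /eqP <-; lia.
(* At a removed site the letters at [x - 1] and [x] differ, so the height step [2 * z x - 1] equals
   [z x - z (x - 1)]. *)
have -> : rank z x = rank z (x - 1) by lia.
by move: sx hx; rewrite /survives; case: (z x); case: (z (x - 1)) => //; lia.
Qed.

Lemma sum_betweenE (f : int -> int) (w x : int) : w <= x -> sum_between f w x = isum f x - isum f (w - 1).
Proof.
rewrite /sum_between => wx.
have -> : x = w + `|x - w|%N%:Z by lia.
rewrite addrAC subrr add0r absz_nat; elim: `|x - w|%N => [|n IH].
  by rewrite big_nat1 addr0 (isum_step f w) addrC addKr.
rewrite big_nat_recr //= IH (isum_step f (w + n.+1%:Z)).
have -> : w + n.+1%:Z - 1 = w + n%:Z by lia.
lia.
Qed.

(** As strict running minima of the height, records can be followed through a removal by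
    [height_thin]. *)
Lemma record_height z x :
  record z x <-> forall y, y < x -> height z x < height z y.
Proof.
split=> [rx y yx|h y yx].
  have := rx (y + 1); rewrite sum_betweenE; last by lia.
  have -> : y + 1 - 1 = y by lia.
  rewrite -/(height z) => /(_ _); have -> : y + 1 <= x by lia.
  by move=> /(_ isT); lia.
rewrite sum_betweenE // -/(height z); have := h (y - 1); lia.
Qed.

Lemma record_letter z x : record z x -> z x = false /\ z (x - 1) = false.
Proof.
move=> /record_height rx.
have h1 := rx (x - 1); have h2 := rx (x - 1 - 1).
have := height_step z x; have := height_step z (x - 1).
have : x - 1 < x by lia.
have : x - 1 - 1 < x by lia.
by move=> /h2 {}h2 /h1 {}h1; case: (z x); case: (z (x - 1)); lia.
Qed.

Lemma record_survives z x : record z x -> survives z x.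
Proof. by move=> /record_letter[zx zx1]; rewrite /survives zx zx1. Qed.

(** A thinned height to the left belongs to a survivor [w] and is, up to a common constant,
    [height z w - z w]. If [z w] is 1 this is [height z (w - 1)], so in both cases it is an old
    height left of the record. *)
Lemma record_thin z x : unbounded_both (survives z) -> record z x ->
  record (thin z) (rank z x).
Proof.
move=> us rx; have [zx _] := record_letter rx.
apply/record_height => y yx; have [w rw sw] := rank_onto us y.
have wx : w < x.
  case: (ltP w x) => // /(lazy_walk_homo (@rank_lazy z)); lia.
rewrite -rw !height_thin zx.
move/record_height: rx => rx; have := rx _ wx.
have := rx (w - 1); have := height_step z w; case: (z w); lia.
Qed.

(** A surviving [x] has larger rank than every [y < x], and the correction [- z y] in [height_thin]
    only strengthens the inequality. *)
Lemma thin_record z x : survives z x -> record (thin z) (rank z x) -> record z x.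
Proof.
move=> sx rx; have [] := record_letter rx; rewrite thin_rank // => zx _.
apply/record_height => y yx; move/record_height: rx.
move=> /(_ (rank z y)); rewrite !height_thin zx.
have /rank_jump jx := sx; have := jump_lt (@rank_lazy z) yx jx.
by move=> h /(_ h); case: (z y); lia.
Qed.

(** [Omega_r] without its density condition: this part transforms pathwise under [thin], while the
    density is handled almost surely. *)
Definition origin_records (z : config) :=
  unbounded_both (record z) /\ record z 0.

Lemma unbounded_both_imp (P Q : int -> Prop) :
  (forall x, P x -> Q x) -> unbounded_both P -> unbounded_both Q.
Proof.
by move=> PQ [ub lb]; split=> m; [have [x ? /PQ] := ub m|have [x ? /PQ] := lb m];
  exists x.
Qed.

Lemma origin_records_survives z : origin_records z -> unbounded_both (survives z).
Proof. by case=> + _; apply: unbounded_both_imp; apply: record_survives. Qed.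

(** Records correspond under [rank], which is monotone and maps the survivors onto the integers, so
    unboundedness passes in both directions; survival of 0 matches the two origins. *)
Lemma origin_records_thin z : unbounded_both (survives z) -> survives z 0 ->
  origin_records (thin z) <-> origin_records z.
Proof.
move=> us s0; have homo := lazy_walk_homo (@rank_lazy z).
split=> -[[ub lb] r0]; (split; [split|]).
- move=> m; have [y my ry] := ub (rank z m); have [x xy sx] := rank_onto us y.
  exists x; last by apply: thin_record; rewrite // xy.
  by case: (ltP m x) => // /homo; lia.
- move=> m; have [y my ry] := lb (rank z m); have [x xy sx] := rank_onto us y.
  exists x; last by apply: thin_record; rewrite // xy.
  by case: (ltP x m) => // /homo; lia.
- by apply: thin_record; rewrite ?rank0.
- move=> m; have [w rw sw] := rank_onto us m; have [x wx rx] := ub w.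
  exists (rank z x); last exact: record_thin.
  rewrite -rw; apply: (jump_lt (@rank_lazy z)) => //.
  exact/rank_jump/record_survives.
- move=> m; have [w rw sw] := rank_onto us m; have [x wx rx] := lb w.
  exists (rank z x); last exact: record_thin.
  rewrite -rw; apply: (jump_lt (@rank_lazy z)) => //.
  exact/rank_jump.
- by rewrite -(rank0 z); apply: record_thin.
Qed.

(** * Carriers *)

(** Index, after [k] removals, of the last remaining site weakly left of [x]; on [origin_records] it
    is shown to be [xi k]. *)
Fixpoint level (z : config) (k : nat) (x : int) : int :=
  if k is k'.+1 then rank (iter k' thin z) (level z k' x) else x.

(* [W_k(x)] is the letter of the last site weakly left of [x] that survives the
   first [k - 1] rounds of thinning. *)
Definition thin_carrier (z : config) (k : nat) (x : int) : bool :=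
  iter k.-1 thin z (level z k.-1 x).

Lemma level_lazy z k : lazy_walk (level z k).
Proof.
elim: k => [|k IH] x /=; first by right; lia.
case: (IH x) => ->; first by left.
have := rank_lazy (iter k thin z) (level z k (x - 1) + 1).
by rewrite addrK.
Qed.

Lemma level_jump_survives z k x : jump (level z k) x -> jump (level z k.+1) x ->
  survives (iter k thin z) (level z k x).
Proof.
move=> jk j; apply/rank_jump.
have e : level z k (x - 1) = level z k x - 1 by rewrite jk addrK.
by move: j; rewrite /jump /= e.
Qed.

(** A jump of [level z k] is a site that has survived every earlier round, and each round keeps the
    letters of its survivors. *)
Lemma level_jump z k x : jump (level z k) x ->
  iter k thin z (level z k x) = z x.
Proof.
elim: k => // k IH j.
have jk : jump (level z k) x.
  by case: (level_lazy z k x) => // e; move: j; rewrite /jump /= e; lia.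
by rewrite iterS /= thin_rank ?IH //; apply: level_jump_survives.
Qed.

(** A site left after [k] rounds survives the next one when it repeats the letter of the preceding
    remaining site, and that letter is what the carrier holds at [x - 1]. *)
Lemma level_jumpS z k x : jump (level z k.+1) x <->
  jump (level z k) x /\ thin_carrier z k.+1 (x - 1) = z x.
Proof.
split=> [j|[jk e]].
  have jk : jump (level z k) x.
    by case: (level_lazy z k x) => // e; move: j; rewrite /jump /= e; lia.
  split=> //; rewrite -(level_jump jk) /thin_carrier /=; apply/esym/eqP.
  have : survives (iter k thin z) (level z k x).
    exact: level_jump_survives.
  by rewrite /survives jk addrK.
rewrite /jump /= (rank_step (iter k thin z) (level z k x)).
rewrite (_ : survives _ _) //; last first.
  by rewrite /survives (level_jump jk) jk addrK; apply/eqP; rewrite -e.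
by rewrite jk addrK.
Qed.

(** Iterating [level_jumpS]: a site survives [k] rounds exactly when the first [k] carriers at
    [x - 1] all equal its letter. There is one product for each letter. *)
Lemma level_moves z k x :
  level z k x - level z k (x - 1) =
  (z x : int) * \prod_(1 <= j < k.+1) (thin_carrier z j (x - 1) : int) +
  (1 - (z x : int)) * \prod_(1 <= j < k.+1) (1 - (thin_carrier z j (x - 1) : int)).
Proof.
elim: k => [|k IH]; first by rewrite !big_nil /=; lia.
rewrite !(@big_nat_recr _ _ _ k.+1) //=.
have := level_lazy z k.+1 x; have := level_lazy z k x.
have := level_jumpS z k x; rewrite /jump.
move: IH; set P1 := \prod_(_ <= _ < _) _; set P2 := \prod_(_ <= _ < _) _.
set w := thin_carrier _ _ _.
case: (z x); case: w => /=; rewrite ?(mulr0, mul0r, mul1r, mulr1, subr0, subrr, addr0, add0r);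
 intuition; try lia.
all: try discriminate.
Qed.

(** Each arrow is a difference of two consecutive products, so the sum over the carriers
    telescopes. *)
Lemma arrow_sum z W k x :
  arrow_up z W k x + arrow_down z W k x =
  ((z x : int) * \prod_(1 <= j < k) (W j (x - 1) : int) +
   (1 - (z x : int)) * \prod_(1 <= j < k) (1 - (W j (x - 1) : int))) -
  ((z x : int) * (\prod_(1 <= j < k) (W j (x - 1) : int) * W k (x - 1)) +
   (1 - (z x : int)) * (\prod_(1 <= j < k) (1 - (W j (x - 1) : int)) * (1 - (W k (x - 1) : int)))).
Proof.
rewrite /arrow_up /arrow_down.
set P1 := \prod_(_ <= _ < _) _; set P2 := \prod_(_ <= _ < _) _.
by case: (z x); case: (W k _); lia.
Qed.

Lemma level_is_xi z k x : level z k x - level z k (x - 1) =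
  1 - \sum_(1 <= j < k.+1)
        (arrow_up z (thin_carrier z) j x + arrow_down z (thin_carrier z) j x).
Proof.
elim: k => [|k IH]; first by rewrite big_nil /=; lia.
rewrite big_nat_recr //= opprD addrA -IH arrow_sum.
have := level_moves z k.+1 x; rewrite !(@big_nat_recr _ _ _ k.+1) //=.
have := level_moves z k x => -> ->.
by rewrite subKr.
Qed.

(** If the level stands still at [x], the carrier is unchanged and the product belonging to the
    letter [z x] is 0; if it jumps, the new carrier is [z x] and that product is 1. *)
Lemma thin_carrier_eq z k x : (0 < k)%N ->
  (thin_carrier z k x : int) =
  (thin_carrier z k (x - 1) : int) + arrow_up z (thin_carrier z) k x
    - arrow_down z (thin_carrier z) k x.
Proof.
case: k => // k _; rewrite /arrow_up /arrow_down.
have := level_moves z k x.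
set P1 := \prod_(_ <= _ < _) _; set P2 := \prod_(_ <= _ < _) _ => mv.
case: (level_lazy z k x) => [e|j].
  have -> : thin_carrier z k.+1 x = thin_carrier z k.+1 (x - 1).
    by rewrite /thin_carrier /= e.
  by move: mv; rewrite e; case: (z x); case: thin_carrier; lia.
have -> : thin_carrier z k.+1 x = z x by rewrite /thin_carrier /= level_jump.
by move: mv; rewrite j; case: (z x); case: thin_carrier; lia.
Qed.

(** Arrows of index [k] involve only carriers of index at most [k] at [x - 1]. Starting from a
    record on the left, where both carriers vanish, the recursion fixes all later values. *)
Lemma carrier_unique z W W' : (forall m, exists2 x, x < m & record z x) ->
  is_carrier z W -> is_carrier z W' -> forall k, (0 < k)%N -> W k =1 W' k.
Proof.
move=> lb cW cW'; elim/ltn_ind => k IH k0 x.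
have [r rx rr] := lb x; move: x {rx}(ltW rx); apply: int_ind_ge.
  by rewrite (cW k k0).1 // (cW' k k0).1.
move=> x _ e; have := (cW k k0).2 x; have := (cW' k k0).2 x.
rewrite /arrow_up /arrow_down e.
have -> : \prod_(1 <= j < k) (W j (x - 1) : int) = \prod_(1 <= j < k) (W' j (x - 1) : int).
  by apply: eq_big_nat => j /andP[j0 jk]; rewrite IH.
have -> : \prod_(1 <= j < k) (1 - (W j (x - 1) : int)) = \prod_(1 <= j < k) (1 - (W' j (x - 1) : int)).
  by apply: eq_big_nat => j /andP[j0 jk]; rewrite IH.
by move=> <-; case: (W k x); case: (W' k x).
Qed.

Section Skip.
Variables (z : config) (rz : origin_records z).

Lemma origin_records_iter k : origin_records (iter k thin z).
Proof.
elim: k => //= k IH; apply/origin_records_thin => //.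
  exact: origin_records_survives.
by apply: record_survives; case: IH.
Qed.

Lemma record_level k x : record z x -> record (iter k thin z) (level z k x).
Proof.
move=> rx; elim: k => //= k IH; apply: record_thin => //.
exact/origin_records_survives/origin_records_iter.
Qed.

Lemma thin_carrierP : is_carrier z (thin_carrier z).
Proof.
move=> k k0; split=> x; last exact: thin_carrier_eq.
by move=> /(@record_level k.-1 _) /record_letter [].
Qed.

Lemma carrierE k : (0 < k)%N -> carrier z k =1 thin_carrier z k.
Proof.
apply: carrier_unique; first by case: rz => -[].
  by apply: (@xgetPex _ _ [set W | is_carrier z W]); exists (thin_carrier z); apply: thin_carrierP.
exact: thin_carrierP.
Qed.

Lemma level0 k : level z k 0 = 0.
Proof. by elim: k => //= k ->; exact: rank0. Qed.

(** The value at 0 and the increments determine a function on the integers, so the choice made by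
    [xget] can only be the level. *)
Lemma xiE k : xi k z =1 level z k.
Proof.
have arrE W W' j x : (0 < j)%N -> (forall i, (0 < i)%N -> W i =1 W' i) ->
    arrow_up z W j x + arrow_down z W j x = arrow_up z W' j x + arrow_down z W' j x.
  move=> j0 e; rewrite !arrow_sum e //.
  congr (_ * _ + _ * _ - (_ * (_ * _) + _ * (_ * _)));
    by apply: eq_big_nat => i /andP[i0 _]; rewrite e.
have incr x : level z k x - level z k (x - 1) = 1 - \sum_(1 <= j < k.+1)
    (arrow_up z (carrier z) j x + arrow_down z (carrier z) j x).
  rewrite level_is_xi; congr (1 - _); apply: eq_big_nat => j /andP[j0 _].
  by apply: arrE => // i i0 y; rewrite carrierE.
have [xi0 xiS] : is_xi z k (xi k z).
  apply: (@xgetPex _ _ [set f | is_xi z k f]); exists (level z k).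
  by split => //; exact: level0.
by apply: eq_increments => [|x]; rewrite ?level0 // xiS incr.
Qed.

(** Records supply the jumps: after any number of rounds a record and its left neighbour both carry
    the letter 0, so the record survives again. *)
Lemma level_onto k x : exists2 y, level z k y = x & jump (level z k) y.
Proof.
apply: lazy_walk_onto; first exact: level_lazy.
have [ur _] := rz; move: ur; apply: unbounded_both_imp => y ry.
elim: k => [|k IH]; first by rewrite /jump /=; lia.
apply/level_jumpS; split=> //; have [-> _] := record_letter ry.
rewrite /thin_carrier /=; have [_] := record_letter (@record_level k _ ry).
by rewrite IH addrK.
Qed.

Lemma skip_siteE k x : z (skip_site k z x) = iter k thin z x.
Proof.
have [y yx jy] := level_onto k x.
have [sx smin] : xi k z (skip_site k z x) = x /\
    forall w, xi k z w = x -> skip_site k z x <= w.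
  apply: (@xgetPex _ _ [set y | xi k z y = x /\ forall w, xi k z w = x -> y <= w]).
  exists y; split; first by rewrite xiE.
  move=> w; rewrite xiE => wx; case: (leP y w) => // wy.
  by have := jump_lt (@level_lazy z k) wy jy; lia.
rewrite xiE in sx; rewrite -{2}sx level_jump //.
(* If the level did not jump at the skip site, the left neighbour would have the same level, against
   minimality. *)
case: (level_lazy z k (skip_site k z x)) => // e.
have := smin (skip_site k z x - 1); rewrite xiE -e => /(_ sx); lia.
Qed.

End Skip.

(** * Measurability *)

Section MeasurablePredicates.
Context {d} {T : measurableType d}.

Lemma measurable_forall (I : countType) (P : I -> T -> Prop) :
  (forall i, measurable [set t | P i t]) -> measurable [set t | forall i, P i t].
Proof.
move=> mP; rewrite (_ : [set t | _] = ~` \bigcup_i ~` [set t | P i t]).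
  apply: measurableC; apply: countable_bigcupT_measurable; first exact: countableP.
  by move=> i; apply: measurableC.
by apply/seteqP; split=> t /= h; [case=> i _; apply | move=> i; apply: contrapT => nP; apply: h; exists i].
Qed.

Lemma measurable_exists (I : countType) (P : I -> T -> Prop) :
  (forall i, measurable [set t | P i t]) -> measurable [set t | exists i, P i t].
Proof.
move=> mP; rewrite (_ : [set t | _] = \bigcup_i [set t | P i t]).
  by apply: countable_bigcupT_measurable => //; exact: countableP.
by apply/seteqP; split=> t /= [i]; [exists i | move=> _ Pi; exists i].
Qed.

Lemma measurable_and (P Q : T -> Prop) : measurable [set t | P t] ->
  measurable [set t | Q t] -> measurable [set t | P t /\ Q t].
Proof. exact: measurableI. Qed.

Lemma measurable_imp (p : Prop) (P : T -> Prop) : measurable [set t | P t] ->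
  measurable [set t | p -> P t].
Proof.
move=> mP; case: (pselect p) => hp.
  by rewrite (_ : [set t | _] = [set t | P t]) //; apply/seteqP; split=> t /=; [apply|].
by rewrite (_ : [set t | _] = setT) //; apply/seteqP; split=> t //= _ /hp.
Qed.

Lemma measurable_conj (p : Prop) (P : T -> Prop) : measurable [set t | P t] ->
  measurable [set t | p /\ P t].
Proof.
move=> mP; case: (pselect p) => hp.
  by rewrite (_ : [set t | _] = [set t | P t]) //; apply/seteqP; split=> t /= // -[].
by rewrite (_ : [set t | _] = set0) //; apply/seteqP; split=> t // -[].
Qed.

Lemma measurable_pred_eq (P Q : T -> Prop) : (forall t, P t <-> Q t) ->
  measurable [set t | Q t] -> measurable [set t | P t].
Proof. by move=> PQ; rewrite (_ : [set t | P t] = [set t | Q t]) //; apply/funext => t; apply/propext. Qed.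

Lemma measurable_to_config (X : T -> config) :
  (forall x, measurable [set t | X t x]) -> measurable_fun setT X.
Proof.
move=> mX; apply: (@measurability _ _ T (g_sigma_algebraType config_cylinders) setT X config_cylinders) => //.
move=> _ [_ [x [s ->]] <-]; rewrite setTI.
case: s; first by apply: (measurable_pred_eq _ (mX x)).
rewrite (_ : _ @^-1` _ = ~` [set t | X t x]); first exact: measurableC.
by apply/seteqP; split=> t /=; case: (X t x).
Qed.

End MeasurablePredicates.

(** * Measurable events of configurations *)

Lemma measurable_letter x s : measurable [set z : config | z x = s].
Proof. by apply: sub_sigma_algebra; exists x, s. Qed.

(** Dependence on finitely many letters: it gives measurability and, with [hi] as the present, the
    past events to which the Markov property is applied. *)
Definition local (lo hi : int) (P : config -> Prop) :=
  forall z z' : config, (forall y, lo <= y <= hi -> z y = z' y) -> P z -> P z'.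

(** The event is a countable union over words [w] of the cylinders on which the window spells [w],
    for those [w] whose extension satisfies [P]. *)
Lemma local_measurable lo hi P : local lo hi P -> measurable [set z | P z].
Proof.
move=> lP; pose n := `|hi - lo|%N.+1.
pose ext (w : seq bool) : config := fun y => nth false w `|y - lo|%N.
apply: (@measurable_pred_eq _ _ _ (fun z : config => exists w : seq bool,
    P (ext w) /\ forall i : nat, (i < n)%N -> z (lo + i%:Z) = nth false w i)).
  move=> z; split.
    move=> Pz; pose w := mkseq (fun i => z (lo + i%:Z)) n.
    exists w; split; last by move=> i ni; rewrite nth_mkseq.
    apply: (lP _ _ _ Pz) => y /andP[ly yh].
    by rewrite /ext nth_mkseq; [congr (z _); lia | rewrite /n; lia].
  move=> [w [Pw zw]]; apply: (lP _ _ _ Pw) => y /andP[ly yh].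
  by rewrite /ext -zw; [congr (z _); lia | rewrite /n; lia].
apply: measurable_exists => w; apply: measurable_conj.
apply: measurable_forall => i; apply: measurable_imp; exact: measurable_letter.
Qed.

Lemma local_widen lo hi lo' hi' P : lo' <= lo -> hi <= hi' ->
  local lo hi P -> local lo' hi' P.
Proof. by move=> ll hh lP z z' e; apply: lP => y /andP[ly yh]; apply: e; lia. Qed.

Lemma local_and lo hi P Q : local lo hi P -> local lo hi Q ->
  local lo hi (fun z => P z /\ Q z).
Proof. by move=> lP lQ z z' e [/(lP _ _ e) ? /(lQ _ _ e)]. Qed.

Definition shift (m : int) (z : config) : config := fun x => z (x + m).

Lemma measurable_shift m : measurable_fun setT (shift m).
Proof. by apply: measurable_to_config => x; exact: (measurable_letter _ true). Qed.

Lemma local_letter x s : local x x (fun z => z x = s).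
Proof. by move=> z z' e <-; rewrite e // lexx. Qed.

Lemma isum_ext (f g : int -> int) (x : int) :
  (forall y, `|y| <= `|x| -> f y = g y) -> isum f x = isum g x.
Proof.
case: x => n fg /=; first by apply: eq_bigr => -[i hi] _; apply: fg => /=; lia.
by congr (- _); apply: eq_bigr => -[i hi] _; apply: fg => /=; lia.
Qed.

Lemma local_rank x y : local (- `|x| - 1) `|x| (fun z => rank z x = y).
Proof.
move=> z z' e <-; apply: isum_ext => w wx; rewrite /survives.
by rewrite !e //; lia.
Qed.

Lemma measurable_survives x : measurable [set z | survives z x].
Proof.
apply: (@local_measurable (x - 1) x) => z z' e.
by rewrite /survives !e //; lia.
Qed.

Lemma measurable_rank x y : measurable [set z | rank z x = y].
Proof. exact: local_measurable (@local_rank x y). Qed.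

Lemma measurable_thin : measurable_fun setT thin.
Proof.
apply: measurable_to_config => x.
apply: (@measurable_pred_eq _ _ _ (fun z => exists y, survives z y /\ (rank z y = x /\ z y = true))).
  move=> z; rewrite /thin; split.
    by move/asboolP => [y [? ? ?]]; exists y.
  by move=> [y [? [? ?]]]; apply/asboolP; exists y.
apply: measurable_exists => y; apply: measurable_and; first exact: measurable_survives.
by apply: measurable_and; [exact: measurable_rank | exact: measurable_letter].
Qed.

Lemma measurable_record x : measurable [set z | record z x].
Proof.
apply: (measurable_pred_eq (fun z => record_height z x)).
apply: measurable_forall => w; apply: measurable_imp.
apply: (@local_measurable (- (`|w| + `|x|)) (`|w| + `|x|)) => z z' e.
have eh y : `|y| <= `|w| + `|x| -> height z y = height z' y.
  by move=> hy; apply: isum_ext => u uy; rewrite e //; lia.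
by rewrite !eh //; lia.
Qed.

Lemma measurable_unbounded (P : config -> int -> Prop) :
  (forall x, measurable [set z | P z x]) ->
  measurable [set z | unbounded_both (P z)].
Proof.
move=> mP; apply: measurable_and; apply: measurable_forall => m.
  apply: (@measurable_pred_eq _ _ _ (fun z => exists x, m < x /\ P z x)).
    by move=> z; split=> -[x]; [exists x | case=> ? ?; exists x].
  by apply: measurable_exists => x; apply: measurable_conj.
apply: (@measurable_pred_eq _ _ _ (fun z => exists x, x < m /\ P z x)).
  by move=> z; split=> -[x]; [exists x | case=> ? ?; exists x].
by apply: measurable_exists => x; apply: measurable_conj.
Qed.

Lemma measurable_origin_records : measurable [set z | origin_records z].
Proof.
apply: measurable_and; last exact: measurable_record.
by apply: measurable_unbounded => x; exact: measurable_record.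
Qed.

Lemma Omega_rE (R : realType) : Omega_r R = Omega R `&` [set z | origin_records z].
Proof.
by apply/seteqP; split=> z /=; [case=> ? ? ? ?|case=> ? [[? ?] ?]]; split => //; split.
Qed.

(** The Cauchy criterion and an eventual bound with a margin avoid naming the limit; only countable
    quantifiers remain, which yields measurability of [Omega]. *)
Lemma cvg_below_iff (R : realType) (u : R^nat) (c : R) :
  (exists2 l : R, u @ \oo --> l & l < c) <->
  (forall k : nat, exists N : nat, forall m : nat, (N <= m)%N -> forall n : nat, (N <= n)%N ->
     `|u m - u n| < k.+1%:R^-1) /\
  (exists k : nat, exists N : nat, forall n : nat, (N <= n)%N -> u n <= c - k.+1%:R^-1).
Proof.
split=> [[l ul lc]|[cau [k0 [N0 hk]]]].
  split.
    move=> k; have e0 : 0 < k.+1%:R^-1 / 2 :> R by rewrite divr_gt0 // invr_gt0.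
    move/cvgrPdist_lt: ul => /(_ _ e0) [N _ hN].
    exists N => m /hN /= hm n /hN /= hn.
    have -> : u m - u n = (l - u n) - (l - u m) by ring.
    by apply: (le_lt_trans (ler_normB _ _)); rewrite [ltRHS]splitr; apply: ltrD.
  have [k kc] : exists k : nat, k.+1%:R^-1 < c - l.
    have : 0 < c - l by rewrite subr_gt0.
    move=> cl; have := near_infty_natSinv_lt (PosNum cl) => -[N _ /(_ N)] /=.
    by move=> h; exists N; apply: h => /=.
  have d0 : 0 < c - k.+1%:R^-1 - l by rewrite addrAC subr_gt0.
  move/cvgrPdist_lt: ul => /(_ _ d0) [N _ hN].
  exists k, N => n /hN /=; rewrite distrC => /(le_lt_trans (ler_norm _)).
  by rewrite ltrD2r => /ltW.
have : cvg (u @ \oo).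
  apply/cauchy_cvgP/cauchyP => e e0.
  have := near_infty_natSinv_lt (PosNum e0) => -[k _ /(_ k (leqnn k))] /= ke.
  have [N hN] := cau k; exists (u N); exists N => // n /= Nn.
  by rewrite /ball_ /= -/(ball _ _ _) -ball_normE /= (lt_trans _ ke) //; apply: hN.
move=> cu; exists (lim (u @ \oo)) => //.
apply: (@le_lt_trans _ _ (c - k0.+1%:R^-1)); last first.
  by rewrite ltrBlDr ltrDl invr_gt0.
by apply: limr_le => //; exists N0 => // n /= /hk.
Qed.

Lemma local_left_density (R : realType) n (r : R) :
  local (- n%:Z) 0 (fun z => left_density R z n = r).
Proof.
move=> z z' e <-; rewrite /left_density; congr (_ * _).
by apply: eq_big_nat => i /andP[_ ni]; rewrite e //; lia.
Qed.

Lemma measurable_Omega (R : realType) : measurable (Omega R).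
Proof.
apply: (measurable_pred_eq (fun z => cvg_below_iff (left_density R z) (1 / 2))).
have ld n r := @local_left_density R n r.
apply: measurable_and.
  apply: measurable_forall => k; apply: measurable_exists => N.
  apply: measurable_forall => m; apply: measurable_imp.
  apply: measurable_forall => n; apply: measurable_imp.
  apply: (@local_measurable (- (m + n)%N%:Z) 0) => z z' e.
  rewrite (ld m (left_density R z m) z z') //; last by move=> y h; apply: e; lia.
  by rewrite (ld n (left_density R z n) z z') // => y h; apply: e; lia.
apply: measurable_exists => k; apply: measurable_exists => N.
apply: measurable_forall => n; apply: measurable_imp.
apply: (@local_measurable (- n%:Z) 0) => z z' e.
by rewrite (ld n (left_density R z n) z z').
Qed.

Lemma measurable_Omega_r (R : realType) : measurable (Omega_r R).
Proof.
rewrite Omega_rE; apply: measurableI; first exact: measurable_Omega.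
exact: measurable_origin_records.
Qed.

Lemma measurable_iter_thin k : measurable_fun setT (iter k thin).
Proof.
elim: k => [|k IH]; first exact: measurable_id.
by apply: (measurableT_comp _ IH); exact: measurable_thin.
Qed.

Lemma PsiE (R : realType) k z : (0 < k)%N -> Psi R k z =
  if z \in Omega_r R then iter k thin z else z.
Proof.
move=> k0; rewrite /Psi; case: pselect => h; last by rewrite memNset.
rewrite mem_set //; apply/funext => x; apply: skip_siteE.
by move: h; rewrite Omega_rE => -[].
Qed.

Lemma measurable_Psi (R : realType) k : (0 < k)%N -> measurable_fun setT (Psi R k).
Proof.
move=> k0.
rewrite (_ : Psi R k = fun z => if z \in Omega_r R then iter k thin z else z); last first.
  by apply/funext => z; rewrite PsiE.
apply: measurable_fun_ifT; last exact: measurable_id.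
  apply: (measurable_fun_bool true); rewrite setTI.
  apply: (measurable_pred_eq _ (measurable_Omega_r R)) => z /=.
  by split; [exact: set_mem | exact: mem_set].
exact: measurable_iter_thin.
Qed.

(** * Real-valued probabilities *)

Lemma cvg_uniqueR (R : realType) (u : R^nat) (l l' : R) :
  u @ \oo --> l -> u @ \oo --> l' -> l = l'.
Proof. by move=> /cvg_lim h /cvg_lim h'; rewrite -h // -h'. Qed.

Section Probability.
Context {R : realType} {d : measure_display} {T : measurableType d}.
Variable P : probability T R.

Definition pr (A : set T) : R := fine (P A).

Lemma prE A : measurable A -> P A = (pr A)%:E.
Proof. by move=> mA; rewrite /pr fineK // fin_num_measure. Qed.

Lemma pr_ge0 A : 0 <= pr A.
Proof. by rewrite fine_ge0. Qed.

Lemma pr_set0 : pr set0 = 0.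
Proof. by rewrite /pr measure0. Qed.

Lemma pr_setT : pr setT = 1.
Proof. by rewrite /pr probability_setT. Qed.

Lemma pr_le A B : measurable A -> measurable B -> A `<=` B -> pr A <= pr B.
Proof. by move=> mA mB AB; rewrite -lee_fin -!prE //; apply: le_measure; rewrite ?inE. Qed.

Lemma pr_setID A B : measurable A -> measurable B ->
  pr A = pr (A `&` B) + pr (A `&` ~` B).
Proof.
move=> mA mB; apply: EFin_inj; rewrite EFinD -!prE //; try by apply: measurableI => //; exact: measurableC.
by rewrite addeC -setDE; exact: measureDI.
Qed.

Lemma pr_split_fin (I : finType) (X : T -> I) A :
  measurable A -> (forall i, measurable [set t | X t = i]) ->
  pr A = \sum_i pr (A `&` [set t | X t = i]).
Proof.
move=> mA mX.
have mS (s : seq I) : measurable [set t | X t \in s].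
  apply: (@measurable_pred_eq _ _ _ (fun t => exists i : I, i \in s /\ X t = i)).
    by move=> t; split=> [h|[i [h ->]]//]; exists (X t).
  by apply: measurable_exists => i; apply: measurable_conj.
suff H (s : seq I) : uniq s -> pr (A `&` [set t | X t \in s]) =
    \sum_(i <- s) pr (A `&` [set t | X t = i]).
  rewrite -(H (index_enum I) (index_enum_uniq I)).
  by congr pr; apply/seteqP; split=> t /= => [At|[]//]; split=> //; rewrite mem_index_enum.
elim: s => [_|i s IH /= /andP[nis us]].
  by rewrite big_nil -pr_set0; congr pr; apply/seteqP; split=> t // -[].
rewrite big_cons -IH // (@pr_setID _ [set t | X t = i]) //; last exact: measurableI.
congr (_ + _); congr pr; apply/seteqP; split=> t /=.
- by move=> [[]].
- by move=> [? <-]; split=> //; split=> //; rewrite inE eqxx.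
- by move=> [[? +] /eqP]; rewrite inE => /orP[/eqP ->|//]; rewrite eqxx.
- move=> [? ts]; split; first by split=> //; rewrite inE ts orbT.
  by move=> e; rewrite e (negbTE nis) in ts.
Qed.

Lemma pr_bigcup_cvg (F : (set T)^nat) : (forall n, measurable (F n)) ->
  (forall m n, (m <= n)%N -> F m `<=` F n) ->
  pr (F n) @[n --> \oo] --> pr (\bigcup_n F n).
Proof.
move=> mF hF; have mU : measurable (\bigcup_n F n) by exact: bigcup_measurable.
apply: fine_cvg; rewrite -prE //.
apply: (@nondecreasing_cvg_mu _ _ _ P) => // m n mn.
exact/subsetPset/hF.
Qed.

Lemma pr_bigcap_cvg (F : (set T)^nat) : (forall n, measurable (F n)) ->
  (forall m n, (m <= n)%N -> F n `<=` F m) ->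
  pr (F n) @[n --> \oo] --> pr (\bigcap_n F n).
Proof.
move=> mF hF; have mU : measurable (\bigcap_n F n) by exact: bigcap_measurable.
apply: fine_cvg; rewrite -prE //.
apply: (@nonincreasing_cvg_mu _ _ _ P) => //; first by rewrite ltey_eq fin_num_measure.
by move=> m n mn; exact/subsetPset/hF.
Qed.

Lemma pr_series_cvg (F : (set T)^nat) : (forall n, measurable (F n)) ->
  (forall m n t, F m t -> F n t -> m = n) ->
  series (fun n => pr (F n)) @ \oo --> pr (\bigcup_n F n).
Proof.
move=> mF dF; have mU : measurable (\bigcup_n F n) by exact: bigcup_measurable.
rewrite (_ : series _ = fun n => fine (\sum_(0 <= i < n) P (F i))%E); last first.
  apply/funext => n; rewrite /series /=; apply: EFin_inj.
  rewrite -sumEFin fineK; first by apply: eq_bigr => i _; rewrite prE.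
  by rewrite sum_fin_num; apply/allP => x /mapP [i _ ->]; apply: fin_num_measure.
apply: fine_cvg; rewrite -prE //.
apply: measure_semi_sigma_additive => // m n _ _ [t [Fm Fn]]; exact: dF Fm Fn.
Qed.

(** The complement of [B] is null, so an almost sure event may be inserted or dropped. *)
Lemma pr0_ae A B : measurable A -> measurable B -> pr B = 1 -> pr A = pr (A `&` B).
Proof.
move=> mA mB B1; rewrite (pr_setID mA mB).
have : pr (~` B) = 0.
  by have := pr_setID measurableT mB; rewrite !setTI pr_setT B1; lra.
have := pr_ge0 (A `&` ~` B).
have : pr (A `&` ~` B) <= pr (~` B).
  have mC := measurableC mB.
  by apply: pr_le => //; exact: measurableI.
by move=> h1 h2 h3; lra.
Qed.

End Probability.

(** * Law of large numbers for stationary chains *)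

Definition deviation {R : realType} (q : R) (n : nat) (z : config) : R :=
  \sum_(0 <= i < n) ((z (- i%:Z) : nat)%:R - q).

Section Chain.
Context {R : realType}.
Variables (nu : probability config R) (p : bool -> bool -> R).
Hypotheses (st : stationary nu) (mk : markov_chain p nu).

Lemma measurable_shift_preimage m A : measurable A ->
  measurable [set z : config | A (shift m z)].
Proof. by move=> mA; have := @measurable_shift m measurableT A mA; rewrite setTI. Qed.

Lemma shift_shift m n z : shift m (shift n z) = shift (m + n) z.
Proof. by apply/funext => x; rewrite /shift addrA. Qed.

Lemma shift0 z : shift 0 z = z.
Proof. by apply/funext => x; rewrite /shift addr0. Qed.

Lemma pr_shift m A : measurable A -> pr nu [set z | A (shift m z)] = pr nu A.
Proof.
have nat_shift (n : nat) B : measurable B -> pr nu [set z | B (shift n%:Z z)] = pr nu B.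
  elim: n B => [|n IH] B mB; first by congr pr; apply/funext => z; rewrite /= shift0.
  rewrite /pr -(st mB) -/(pr nu _) -/(pr nu [set z | B (shift 1 z)]).
  rewrite -(IH [set z | B (shift 1 z)]); last exact: measurable_shift_preimage.
  by congr pr; apply/funext => z /=; rewrite shift_shift; congr (B (shift _ z)); lia.
case: m => [n|n] mA; first exact: nat_shift.
rewrite -(nat_shift n.+1 [set z | A (shift (Negz n) z)]); last exact: measurable_shift_preimage.
congr pr; apply/funext => z /=; rewrite shift_shift.
by rewrite (_ : Negz n + n.+1%:Z = 0) ?shift0 //; lia.
Qed.

(** Read leftwards from [x], so that the newest letter is the head and a step of the chain is a
    [cons]. *)
Definition window (x : int) (n : nat) (z : config) : n.-tuple bool :=
  [tuple z (x - (i : nat)%:Z) | i < n].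

Lemma window_nth x n z i : (i < n)%N -> nth false (window x n z) i = z (x - i%:Z).
Proof. by move=> ni; rewrite -[i]/(nat_of_ord (Ordinal ni)) -tnth_nth tnth_mktuple. Qed.

Lemma window_eq x n z (u : n.-tuple bool) :
  window x n z = u <-> forall i, (i < n)%N -> z (x - i%:Z) = nth false u i.
Proof.
split=> [<- i ni|h]; first by rewrite window_nth.
apply: val_inj; apply: (@eq_from_nth _ false); rewrite ?size_tuple // => i ni.
by rewrite window_nth // h.
Qed.

Lemma measurable_window x n u : measurable [set z | window x n z = u].
Proof.
apply: (measurable_pred_eq (fun z => window_eq x z u)).
apply: measurable_forall => i; apply: measurable_imp; exact: measurable_letter.
Qed.

(** The chain hypothesis concerns full words. A past event is a finite disjoint union of words
    reaching back to [lo], all with the same present letter [r]. *)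
Lemma pr_markov lo x (P : config -> Prop) r s : local lo x P ->
  (forall z, P z -> z x = r) ->
  pr nu [set z | P z /\ z (x + 1) = s] = pr nu [set z | P z] * p r s.
Proof.
move=> lP Pr.
have mP := local_measurable lP.
have mPs : measurable [set z | P z /\ z (x + 1) = s].
  by apply: measurable_and => //; exact: measurable_letter.
pose n := `|x - lo|%N.
have mw := @measurable_window x n.+1.
rewrite (pr_split_fin nu mPs mw) (pr_split_fin nu mP mw) mulr_suml.
apply: eq_bigr => u _.
case: (pselect (exists z0, P z0 /\ window x n.+1 z0 = u)) => [[z0 [Pz0 wz0]]|no].
  pose past := [set z : config | forall i : nat, (i <= n)%N -> z (x - i%:Z) = z0 (x - i%:Z)].
  have pastE z : past z <-> window x n.+1 z = u.
    rewrite window_eq -wz0; split=> h i ni; first by rewrite window_nth // h.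
    by rewrite h // window_nth.
  have pastP z : past z -> P z.
    move=> pz; apply: (lP _ _ _ Pz0) => y /andP[ly yx].
    have -> : y = x - `|x - y|%N%:Z by lia.
    by rewrite pz // /n; lia.
  have := mk x n z0 s; rewrite -/past (Pr _ Pz0) /pr.
  rewrite (_ : past `&` _ = [set z | P z /\ z (x + 1) = s] `&` [set z | window x n.+1 z = u]); last first.
    apply/seteqP; split=> z /=.
      by move=> [pz zs]; split; [split=> //; exact: pastP | exact/pastE].
    by move=> [[_ zs] /pastE].
  have -> : past = [set z | P z] `&` [set z | window x n.+1 z = u].
    apply/seteqP; split=> z /=.
      by move=> pz; split; [exact: pastP | exact/pastE].
    by move=> [_ /pastE].
  move=> ->; rewrite fineM // ?fin_num_measure //.
  by apply: measurableI => //; exact: mw.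
rewrite [X in pr nu X](_ : _ = set0) ?[X in _ = pr nu X * _](_ : _ = set0) ?pr_set0 ?mul0r //.
  by apply/seteqP; split=> z // -[Pz wz]; apply: no; exists z.
by apply/seteqP; split=> z // -[[Pz _] wz]; apply: no; exists z.
Qed.

(** Expectation of a function of the window at 0, as a finite sum over words. *)
Definition wmean (n : nat) (phi : seq bool -> R) : R :=
  \sum_(u : n.-tuple bool) pr nu [set z | window 0 n z = u] * phi u.

Lemma wmeanD n phi psi : wmean n (fun u => phi u + psi u) = wmean n phi + wmean n psi.
Proof. by rewrite -big_split /=; apply: eq_bigr => u _; rewrite mulrDr. Qed.

Lemma wmeanZ n c phi : wmean n (fun u => c * phi u) = c * wmean n phi.
Proof. by rewrite mulr_sumr; apply: eq_bigr => u _; rewrite mulrCA. Qed.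

Lemma eq_wmean n phi psi : phi =1 psi -> wmean n phi = wmean n psi.
Proof. by move=> e; apply: eq_bigr => u _; rewrite e. Qed.

Lemma wmean_cst n c : wmean n (fun=> c) = c.
Proof.
rewrite /wmean -mulr_suml -[RHS]mul1r -(pr_setT nu); congr (_ * _).
rewrite (pr_split_fin nu measurableT (@measurable_window 0 n)).
by apply: eq_bigr => u _; rewrite setTI.
Qed.

Lemma wmean_head n (g : bool -> R) : wmean n.+1 (fun u => g (head false u)) =
  pr nu [set z | z 0 = true] * g true + pr nu [set z | z 0 = false] * g false.
Proof.
have mw := @measurable_window 0 n.+1.
rewrite (pr_split_fin nu (measurable_letter 0 true) mw) (pr_split_fin nu (measurable_letter 0 false) mw).
rewrite !mulr_suml -big_split; apply: eq_bigr => u _ /=.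
have hu z : window 0 n.+1 z = u -> z 0 = head false u.
  by move/window_eq => /(_ 0%N isT); rewrite subr0 nth0.
have e0 b : b != head false u ->
    pr nu ([set z | z 0 = b] `&` [set z | window 0 n.+1 z = u]) = 0.
  move=> bu; rewrite -(pr_set0 nu); congr pr; apply/seteqP; split=> z // -[/= zb /hu].
  by rewrite zb => e; rewrite e eqxx in bu.
have e1 b : b = head false u ->
    [set z | z 0 = b] `&` [set z | window 0 n.+1 z = u] = [set z | window 0 n.+1 z = u].
  by move=> ->; apply/seteqP; split=> z /= => [[]//|wz]; split=> //; exact: hu.
case E : (head false u).
  by rewrite (e0 false) ?E // (e1 true) ?E // mul0r addr0.
by rewrite (e0 true) ?E // (e1 false) ?E // mul0r add0r.
Qed.

(** Stationarity moves the window so that it ends at 1; the Markov property then averages over its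
    newest letter given the one before. *)
Lemma wmeanS n phi : wmean n.+2 phi =
  wmean n.+1 (fun u => p (head false u) true * phi (true :: u) +
                       p (head false u) false * phi (false :: u)).
Proof.
rewrite /wmean (reindex (fun q : bool * n.+1.-tuple bool => cons_tuple q.1 q.2)) /=; last first.
  exists (fun t => (thead t, behead_tuple t)) => [[s t] _|t _] /=.
    by rewrite theadE; congr (_, _); exact: val_inj.
  by apply: val_inj; case/tupleP: t => s t /=; rewrite theadE.
rewrite -(pair_bigA _ (fun s (w : n.+1.-tuple bool) =>
  pr nu [set z | window 0 n.+2 z = cons_tuple s w] * phi (s :: w))) /=.
rewrite exchange_big; apply: eq_bigr => w _ /=; rewrite big_bool /= mulrDr.
have H s : pr nu [set z | window 0 n.+2 z = cons_tuple s w] =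
    pr nu [set z | window 0 n.+1 z = w] * p (head false w) s.
  rewrite -(pr_shift 1 (@measurable_window 0 n.+2 _)) -(@pr_markov (- n%:Z) 0 (fun z => window 0 n.+1 z = w)).
  - congr pr; apply/funext => z /=; apply/propext; rewrite !window_eq; split.
      move=> h; split; last by have := h 0%N isT; rewrite /shift /= subr0 add0r.
      by move=> i ni; have := h i.+1 ni; rewrite /shift /= => <-; congr z; lia.
    move=> [h zs] [|i] ni; first by rewrite /shift subr0 zs.
    by rewrite /= -(h i ni) /shift; congr z; lia.
  - move=> z z' e; rewrite !window_eq => h i ni; rewrite -h // e //; lia.
  - by move=> z /window_eq /(_ 0%N isT); rewrite subr0 nth0.
by rewrite !H !mulrA.
Qed.

(** * Second moments of centred letter sums *)

Variables (q lam : R).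
Hypotheses (p1 : forall r, p r true + p r false = 1)
  (pq : forall r, p r true - q = lam * ((r : nat)%:R - q))
  (lam1 : `|lam| < 1) (q0 : pr nu [set z | z 0 = true] = q).

Let f (s : bool) : R := (s : nat)%:R - q.
Let S (u : seq bool) : R := \sum_(s <- u) f s.
Let v : R := q * (1 - q).

Lemma stationary_q01 : 0 <= q <= 1.
Proof.
rewrite -q0 pr_ge0 -(pr_setT nu) pr_le //; exact: measurable_letter.
Qed.

Let q0' : pr nu [set z | z 0 = false] = 1 - q.
Proof.
have := pr_setID nu measurableT (measurable_letter 0 true).
rewrite !setTI pr_setT q0 => ->; rewrite addrC addKr; congr pr.
by apply/seteqP; split=> z /=; case: (z 0).
Qed.

(** The centred letter [f] is an eigenfunction of the transition matrix with eigenvalue [lam]. *)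
Let step1 r : p r true * f true + p r false * f false = lam * f r.
Proof. by have := pq r; have := p1 r; rewrite /f /=; nra. Qed.

(** On two letters [f ^+ 2] is affine in [f], namely [v + (1 - 2 * q) * f], so [step1] applies
    again. *)
Let step2 r : p r true * f true ^+ 2 + p r false * f false ^+ 2 =
  v + (1 - 2 * q) * (lam * f r).
Proof.
rewrite -step1 /v; have -> : p r true = 1 - p r false by have := p1 r; lra.
by rewrite /f /=; ring.
Qed.

Let mean_f n : wmean n.+1 (fun u => f (head false u)) = 0.
Proof. by rewrite (wmean_head n f) q0 q0' /f /=; ring. Qed.

(** The correlation of the newest letter with the sum; together with the second moment [M] it
    satisfies a closed linear recursion. *)
Let c n := wmean n.+1 (fun u => f (head false u) * S u).
Let M n := wmean n.+1 (fun u => S u ^+ 2).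

Let cS n : c n.+1 = v + lam * c n.
Proof.
rewrite /c wmeanS -[v in RHS](wmean_cst n.+1) -wmeanZ.
(* The term of [step2] that is linear in [f] has mean 0; its negative is added here so that the
   integrands agree letter by letter. *)
rewrite -[LHS]addr0 -[X in _ + X](mulr0 (- (1 - 2 * q) * lam)) -(mean_f n) -wmeanZ -!wmeanD.
apply: eq_wmean => u; rewrite /S !big_cons /= -/(S u).
set r := head false u; have := step1 r; have := step2 r; move: (S u) => s.
move: (p r true) (p r false) (f r) (f true) (f false) => a1 a2 fr f1 f2 h2 h1.
have -> : a1 * (f1 * (f1 + s)) + a2 * (f2 * (f2 + s)) =
  (a1 * f1 ^+ 2 + a2 * f2 ^+ 2) + (a1 * f1 + a2 * f2) * s by ring.
by rewrite h1 h2; ring.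
Qed.

Let MS n : M n.+1 = M n + v + 2 * lam * c n.
Proof.
rewrite /M wmeanS -[v in RHS](wmean_cst n.+1) /c -wmeanZ.
rewrite -[LHS]addr0 -[X in _ + X](mulr0 (- (1 - 2 * q) * lam)) -(mean_f n) -wmeanZ -!wmeanD.
apply: eq_wmean => u; rewrite /S !big_cons /= -/(S u).
set r := head false u; have := step1 r; have := step2 r; have := p1 r; move: (S u) => s.
move: (p r true) (p r false) (f r) (f true) (f false) => a1 a2 fr f1 f2 h0 h2 h1.
have -> : a1 * (f1 + s) ^+ 2 + a2 * (f2 + s) ^+ 2 =
  (a1 * f1 ^+ 2 + a2 * f2 ^+ 2) + 2 * (a1 * f1 + a2 * f2) * s + (a1 + a2) * s ^+ 2 by ring.
by rewrite h1 h2 h0; ring.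
Qed.

Let head1 n : wmean n.+1 (fun u => f (head false u) ^+ 2) = v.
Proof. by rewrite (wmean_head n (fun s => f s ^+ 2)) q0 q0' /f /v /=; ring. Qed.

Let first_window (g : seq bool -> R) (h : bool -> R) : (forall s, g [:: s] = h s) ->
  wmean 1 g = wmean 1 (fun u => h (head false u)).
Proof. by move=> gh; apply: eq_bigr => u _; case/tupleP: u => s u; rewrite tuple0 /= gh. Qed.

(** The constant [C] solves [C = v + |lam| * C], so it bounds every correlation [c n]; each step
    then raises [M] by at most [3 * C]. *)
Lemma second_moment_linear : exists2 K, 0 <= K & forall n, M n <= K * n.+1%:R.
Proof.
have /andP[q_ge0 q_le1] := stationary_q01.
have v0 : 0 <= v by rewrite /v mulr_ge0 // subr_ge0.
have l1 : 0 < 1 - `|lam| by rewrite subr_gt0.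
pose C := v / (1 - `|lam|).
have C0 : 0 <= C by rewrite divr_ge0 // ltW.
have eC : v + `|lam| * C = C.
  have -> : v = C * (1 - `|lam|) by rewrite /C divfK // gt_eqF.
  by ring.
have vC : v <= C by rewrite -eC lerDl mulr_ge0.
have c0 : c 0 = v.
  rewrite /c -(head1 0) (first_window (h := fun s => f s ^+ 2)) //.
  by move=> s; rewrite /S big_seq1 /= expr2.
have M0 : M 0 = v.
  rewrite /M -(head1 0) (first_window (h := fun s => f s ^+ 2)) //.
  by move=> s; rewrite /S big_seq1.
have cC n : `|c n| <= C.
  elim: n => [|n IH]; first by rewrite c0 ger0_norm.
  rewrite cS -[leRHS]eC (le_trans (ler_normD _ _)) // (ger0_norm v0) lerD2l normrM.
  by rewrite ler_wpM2l.
exists (C + 2 * C) => [|n]; first by lra.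
elim: n => [|n IH]; first by rewrite M0; lra.
rewrite MS -[n.+2%:R]natr1 mulrDr mulr1 -addrA lerD // lerD //.
rewrite (le_trans (ler_norm _)) // !normrM (ger0_norm (ler0n _ _)) -mulrA ler_wpM2l //.
by rewrite -[leRHS]mul1r ler_pM // ltW.
Qed.

(** Chebyshev's inequality word by word: a word with [|S u| < t] contributes nothing on the left. *)
Lemma chebyshev_window n (t : R) : 0 <= t ->
  pr nu [set z | t <= `|S (window 0 n.+1 z)|] * t ^+ 2 <= M n.
Proof.
move=> t0; have mw := @measurable_window 0 n.+1.
have mA : measurable [set z | t <= `|S (window 0 n.+1 z)|].
  apply: (@local_measurable (- n%:Z) 0) => z z' e.
  suff -> : window 0 n.+1 z = window 0 n.+1 z' by [].
  by apply/window_eq => i ni; rewrite window_nth // e //; lia.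
rewrite (pr_split_fin nu mA mw) mulr_suml; apply: ler_sum => u _.
case: (leP t `|S u|) => tS.
  apply: ler_pM => //; rewrite ?pr_ge0 ?sqr_ge0 //.
    by apply: pr_le => //; exact: measurableI.
  by rewrite -[leRHS]real_normK ?num_real // ler_pXn2r // nnegrE.
rewrite (_ : _ `&` _ = set0).
  by rewrite pr_set0 mul0r mulr_ge0 // ?pr_ge0 // sqr_ge0.
by apply/seteqP; split=> z // [tz wz]; move: tz; rewrite /mkset wz leNgt tS.
Qed.

Lemma deviation_bound : exists2 K, 0 <= K & forall n (t : R), 0 <= t ->
  pr nu [set z | t <= `|deviation q n.+1 z|] * t ^+ 2 <= K * n.+1%:R.
Proof.
have [K K0 hK] := second_moment_linear; exists K => // n t t0.
apply: le_trans (hK n); apply: le_trans (chebyshev_window n t0).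
suff e z : S (window 0 n.+1 z) = deviation q n.+1 z.
  by rewrite (_ : [set z | _] = [set z | t <= `|S (window 0 n.+1 z)|]) //; apply/funext => z; rewrite /mkset e.
rewrite /S (big_nth false) size_tuple; apply: eq_big_nat => i /andP[_ ni].
by rewrite window_nth // sub0r.
Qed.

End Chain.

(** * From the deviation bound to the density *)

Section LawOfLargeNumbers.
Context {R : realType}.
Variables (q : R).
Hypothesis (q01 : 0 <= q <= 1).

Lemma deviation_drift n k z :
  `|deviation q (n + k) z - deviation q n z| <= k%:R.
Proof.
elim: k => [|k IH]; first by rewrite addn0 subrr normr0.
rewrite addnS /deviation big_nat_recr //= -/(deviation q (n + k) z) -/(deviation q n z) addrAC.
apply: (le_trans (ler_normD _ _)); rewrite -natr1 lerD //.
by rewrite ler_norml; case: (z _) => /=; move/andP: q01 => [? ?]; apply/andP; split; lra.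
Qed.

(** The density divides a sum of [n + 1] letters by [n], whence the extra [q]. *)
Lemma left_densityE n z : (0 < n)%N ->
  left_density R z n - q = (deviation q n.+1 z + q) / n%:R.
Proof.
move=> n0; rewrite /left_density /deviation sumrB sumr_const_nat subn0 -[q *+ n.+1]mulr_natr.
rewrite -natr1; have : n%:R != 0 :> R by rewrite pnatr_eq0 -lt0n.
by move=> nn; field.
Qed.

Lemma sqrt_floor (n : nat) : exists m, (m ^ 2 <= n < m.+1 ^ 2)%N.
Proof.
elim: n => [|n [m /andP[mn nm]]]; first by exists 0%N.
case: (leqP (m.+1 ^ 2) n.+1) => h; last by exists m; rewrite h andbT; lia.
by exists m.+1; rewrite h /=; nia.
Qed.

(** Consecutive squares near [n] are only of order the square root of [n] apart, so the deviation
    between them is negligible after division by [n]. *)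
Lemma density_along_squares z :
  (forall j : nat, exists N : nat, forall m, (N <= m)%N ->
     `|deviation q (m.+1 ^ 2) z| < (m.+1 ^ 2)%:R / j.+1%:R) ->
  left_density R z @ \oo --> q.
Proof.
move=> dz; apply/cvgrPdist_lt => e e0.
(* With [x = m + 1], [dl = 1 / (j + 1) < e / 8], [1 <= x * dl] and [2 <= x], the bound
   [x^2 dl + 2x + 2] is at most [4 x^2 dl], hence below [e x^2 / 2 <= e n]. *)
have e8 : 0 < e / 8 by lra.
have := near_infty_natSinv_lt (PosNum e8) => -[j _ /(_ j (leqnn j))] /= je.
have [N hN] := dz j.
exists ((N + j).+2 ^ 2)%N => // n /= Nn.
have [[|m] /andP[mn nm]] := sqrt_floor n.+1; first by nia.
have Nm : (N + j < m)%N by nia.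
have n0 : (0 < n)%N by nia.
have jm : (j < m.+1)%N by lia.
have m0 : (0 < m)%N by lia.
rewrite distrC left_densityE // normrM [X in _ * X]ger0_norm ?invr_ge0 //.
rewrite ltr_pdivrMr ?ltr0n //.
have hm := hN m ltac:(lia).
have dr := deviation_drift (m.+1 ^ 2) (n.+1 - m.+1 ^ 2) z.
rewrite subnKC // in dr.
set x : R := m.+1%:R; set dl : R := j.+1%:R^-1.
have ex : (m.+1 ^ 2)%:R = x ^+ 2 :> R by rewrite natrX.
have kx : (n.+1 - m.+1 ^ 2)%:R <= 2 * x + 1 :> R.
  by rewrite -[2]/(2%:R) -natrM natr1 ler_nat; nia.
have nx : x ^+ 2 / 2 <= n%:R.
  by rewrite ler_pdivrMr // -natrX -natrM ler_nat; nia.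
have xd : 1 <= x * dl.
  by rewrite ler_pdivlMr // mul1r ler_nat.
have x2 : 2 <= x by rewrite ler_nat ltnS.
have dl0 : 0 < dl by rewrite invr_gt0.
have b1 : `|deviation q n.+1 z + q| <= x ^+ 2 * dl + (2 * x + 1) + 1.
  apply: (le_trans (ler_normD _ _)); apply: lerD; last first.
    by rewrite ger0_norm; case/andP: q01.
  rewrite -[deviation q n.+1 z](subrK (deviation q (m.+1 ^ 2) z)) addrC.
  apply: (le_trans (ler_normD _ _)); apply: lerD; last exact: le_trans dr kx.
  by rewrite -ex ltW.
apply: (le_lt_trans b1); apply: (@lt_le_trans _ _ (e * (x ^+ 2 / 2))); last first.
  by rewrite ler_wpM2l // ltW.
have : dl * x ^+ 2 < e / 8 * x ^+ 2 by rewrite ltr_pM2r // exprn_gt0 //; lra.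
have : x * (x * dl) >= x * 1 by rewrite ler_wpM2l //; lra.
rewrite (_ : x * (x * dl) = dl * x ^+ 2); last by ring.
move=> h1 h2; rewrite (mulrC (x ^+ 2) dl); lra.
Qed.

Lemma sum_inv_squares n : \sum_(0 <= m < n) (m.+1%:R ^+ 2)^-1 <= 2 :> R.
Proof.
(* The sharper bound makes the induction work: [1 / (x + 1)^2] is at most [1 / x - 1 / (x + 1)]. *)
suff H k : \sum_(0 <= m < k.+1) (m.+1%:R ^+ 2)^-1 <= 2 - k.+1%:R^-1 :> R.
  case: n => [|n]; first by rewrite big_nil.
  by apply: (le_trans (H n)); rewrite lerBlDr lerDl invr_ge0.
elim: k => [|k IH]; first by rewrite big_nat1 expr1n invr1; lra.
rewrite big_nat_recr //=; apply: (le_trans (lerD IH (lexx _))).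
rewrite -[k.+2%:R]natr1; set x : R := k.+1%:R; have x0 : 0 < x by rewrite ltr0n.
have -> : 2 - (x + 1)^-1 = 2 - x^-1 + (x * (x + 1))^-1.
  by field; rewrite !gt_eqF //; lra.
rewrite lerD2l lef_pV2 ?posrE ?mulr_gt0 ?exprn_gt0 //; nra.
Qed.

(** Borel-Cantelli for each tolerance [1 / (j + 1)]: along squares the variance bound gives bad
    events of probability [O(1 / (m + 1)^2)]. A countable union over [j] finishes. *)
Lemma density_lt_half_as (nu : probability config R) : q < 1 / 2 ->
  (exists2 K, 0 <= K & forall n (t : R), 0 <= t ->
     pr nu [set z | t <= `|deviation q n.+1 z|] * t ^+ 2 <= K * n.+1%:R) ->
  pr nu (Omega R) = 1.
Proof.
move=> q12 [K K0 hK].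
pose Bad (j m : nat) := [set z : config | (m.+1 ^ 2)%:R / j.+1%:R <= `|deviation q (m.+1 ^ 2) z|].
have mBad j m : measurable (Bad j m).
  apply: (@local_measurable (- (m.+1 ^ 2)%N%:Z) 0) => z z' e.
  suff -> : deviation q (m.+1 ^ 2) z = deviation q (m.+1 ^ 2) z' by [].
  by apply: eq_big_nat => i ni; rewrite e //; lia.
have pBad j m : pr nu (Bad j m) <= K * j.+1%:R ^+ 2 * (m.+1%:R ^+ 2)^-1.
  have := hK (m.+1 ^ 2).-1 ((m.+1 ^ 2)%:R / j.+1%:R).
  rewrite prednK ?expn_gt0 // => /(_ (divr_ge0 (ler0n _ _) (ler0n _ _))).
  rewrite -/(Bad j m) natrX; set x : R := m.+1%:R; set y : R := j.+1%:R.
  have x0 : 0 < x by rewrite ltr0n.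
  have y0 : 0 < y by rewrite ltr0n.
  rewrite -ler_pdivlMr; last by rewrite exprn_gt0 // divr_gt0 // exprn_gt0.
  move=> h; apply: (le_trans h); rewrite le_eqVlt; apply/orP; left; apply/eqP.
  by field; rewrite !gt_eqF.
have sBad j : (\sum_(m <oo) nu (Bad j m) < +oo)%E.
  apply: (@le_lt_trans _ _ (K * j.+1%:R ^+ 2 * 2)%:E); last exact: ltry.
  apply: lime_le; first exact: is_cvg_nneseries.
  apply: nearW => n; rewrite (eq_bigr (fun m => (pr nu (Bad j m))%:E)); last first.
    by move=> m _; rewrite prE.
  rewrite sumEFin lee_fin; apply: (le_trans (ler_sum _ (fun m _ => pBad j m))).
  by rewrite -mulr_sumr ler_wpM2l ?sum_inv_squares // mulr_ge0 // exprn_ge0.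
have mlim j : measurable (lim_sup_set (Bad j)).
  by apply: bigcapT_measurable => k; exact: bigcup_measurable.
have nlim : nu (\bigcup_j lim_sup_set (Bad j)) = 0.
  apply: measure_negligible; first exact: bigcup_measurable.
  apply: negligible_bigcup => j; apply/negligibleP => //.
  exact: (lim_sup_set_cvg0 (mBad j) (sBad j)).
pose L := ~` \bigcup_j lim_sup_set (Bad j).
have mL : measurable L by apply: measurableC; exact: bigcup_measurable.
have pL : pr nu L = 1.
  by rewrite /pr /L probability_setC ?nlim ?sube0 //; exact: bigcup_measurable.
have LO : L `<=` Omega R.
  move=> z Lz; exists q => //; apply: density_along_squares => j.
  apply: contrapT => no; apply: Lz; exists j => // N _.
  apply: contrapT => no2; apply: no; exists N => m Nm; rewrite ltNge.
  by apply/negP => h; apply: no2; exists m.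
apply/eqP; rewrite eq_le -{1}(pr_setT nu) -{1}pL !pr_le //; exact: measurable_Omega.
Qed.

End LawOfLargeNumbers.

(** * Thinning a stationary chain *)

Lemma survives_shift m z x : survives (shift m z) x = survives z (x + m).
Proof. by rewrite /survives /shift addrAC. Qed.

Lemma rank_shift m z x : rank (shift m z) x = rank z (x + m) - rank z m.
Proof.
move: x; apply: eq_increments => [|x]; first by rewrite rank0 add0r subrr.
have e : x + m - 1 = x - 1 + m by ring.
by rewrite (rank_step (shift m z) x) (rank_step z (x + m)) survives_shift e; ring.
Qed.

Definition gap (z : config) (n : nat) : Prop :=
  forall i : nat, (0 < i <= n)%N -> ~~ survives z i%:Z.

(** Implies [thin z 1 = s] and also records that a survivor exists right of 0; it is a countable
    union of local events. *)
Definition next_letter (z : config) (s : bool) : Prop :=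
  exists n : nat, [/\ gap z n, survives z n.+1%:Z & z n.+1%:Z = s].

Lemma gapS z n : gap z n.+1 <-> gap z n /\ ~~ survives z n.+1%:Z.
Proof.
split=> [g|[g ns] i /andP[i0 i1]].
  by split=> [i /andP[i0 ni]|]; apply: g; rewrite ?i0 //=; lia.
by move: i1; rewrite leq_eqVlt => /orP[/eqP ->//|i1]; apply: g; rewrite i0.
Qed.

Lemma gap_alternates z n : gap z n -> z n%:Z = z 0 (+) odd n.
Proof.
elim: n => [|n IH]; first by rewrite addbF.
move=> /gapS[/IH zn]; rewrite /survives (_ : n.+1%:Z - 1 = n%:Z); last by lia.
by rewrite zn /=; case: (z n.+1); case: (z 0); case: (odd n).
Qed.

Lemma gap_rank z n : gap z n -> rank z n%:Z = 0.
Proof.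
elim: n => [|n IH]; first by rewrite rank0.
move=> /gapS[/IH rn /negbTE ns]; rewrite rank_step ns.
by rewrite (_ : n.+1%:Z - 1 = n%:Z) ?rn //; lia.
Qed.

Lemma gap_survivor_rank z n : gap z n -> survives z n.+1%:Z -> rank z n.+1%:Z = 1.
Proof.
move=> g s; rewrite rank_step s (_ : n.+1%:Z - 1 = n%:Z) ?gap_rank //; lia.
Qed.

Lemma gap_unique z m n : gap z m -> survives z m.+1%:Z -> gap z n ->
  survives z n.+1%:Z -> m = n.
Proof.
move=> gm sm gn sn; case: (ltngtP m n) => // h.
  by have := gn m.+1; rewrite /= h sm => /(_ isT).
by have := gm n.+1; rewrite /= h sn => /(_ isT).
Qed.

Lemma next_survivor z (x : int) : 0 < x -> survives z x ->
  exists n, gap z n /\ survives z n.+1%:Z.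
Proof.
move=> x0 sx; have : exists n : nat, survives z n.+1%:Z.
  by exists `|x|.-1; rewrite (_ : _.+1%:Z = x) //; lia.
move=> ex; case: (ex_minnP ex) => n sn nmin; exists n; split=> // i /andP[i0 ni].
by apply/negP => si; have := nmin i.-1; rewrite prednK // => /(_ si); lia.
Qed.

Lemma thin_next_letter z s : next_letter z s -> thin z 1 = s.
Proof. by move=> [n [g sn <-]]; rewrite -(gap_survivor_rank g sn) thin_rank. Qed.

Lemma local_gap n : local 0 n%:Z (fun z => gap z n).
Proof.
move=> z z' e g i ni; have := g i ni; rewrite /survives !e //; lia.
Qed.

Lemma lazy_walk_between f x0 x1 y : lazy_walk f -> f x0 < y -> y <= f x1 ->
  exists u, [/\ x0 < u, u <= x1, f u = y & jump f u].
Proof.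
move=> lf h0 h1; have x01 : x0 <= x1.
  by case: (leP x0 x1) => // /ltW /(lazy_walk_homo lf); lia.
suff : f x1 < y \/ exists u, [/\ x0 < u, u <= x1, f u = y & jump f u].
  by case=> //; lia.
move: x1 x01 {h1}; apply: int_ind_ge; first by left.
move=> x xx [h|[u [? ? ? ?]]]; last by right; exists u; split => //; lia.
have := lf x; case: (ltP (f x) y); first by left.
by move=> ? ?; right; exists x; rewrite /jump; split; lia.
Qed.

Section ThinnedChain.
Context {R : realType}.
Variables (nu : probability config R) (p : bool -> bool -> R).
Hypotheses (st : stationary nu) (mk : markov_chain p nu).
Hypotheses (p1 : forall r, p r true + p r false = 1).
Let a := p false true * p true false.
Hypotheses (a01 : 0 <= a < 1).

Definition thin_mx (r s : bool) : R :=
  (if r == s then p r r else p r s * p s s) / (1 - p false true * p true false).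

(** As [p s s = 1 - p s r], the two numerators of a row add up to [1 - a]. *)
Lemma thin_mx_sum r : thin_mx r true + thin_mx r false = 1.
Proof.
have a1 : 1 - a != 0 by case/andP: a01 => _ h; rewrite gt_eqF // subr_gt0.
rewrite /thin_mx -mulrDl -/a; apply: (canLR (mulfK a1)); rewrite mul1r /a.
by have := p1 true; have := p1 false; case: r => /= h1 h2; nra.
Qed.

Section NextSurvivor.
Variables (lo : int) (A : config -> Prop) (r : bool).
Hypotheses (lo0 : lo <= 0) (lA : local lo 0 A) (Ar : forall z, A z -> z 0 = r).

Let Alt n z := A z /\ gap z n.

Let lAlt n : local lo n%:Z (Alt n).
Proof.
apply: local_and; first by apply: local_widen lA; lia.
by apply: local_widen (@local_gap n); lia.
Qed.

Let alt n := r (+) odd n.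

Let Alt_end n z : Alt n z -> z n%:Z = alt n.
Proof. by move=> [/Ar e /gap_alternates ->]; rewrite e. Qed.

Let pr_AltS n : pr nu [set z | Alt n.+1 z] = pr nu [set z | Alt n z] * p (alt n) (alt n.+1).
Proof.
rewrite -(pr_markov mk (alt n.+1) (@lAlt n) (@Alt_end n)); congr pr.
have nS : n.+1%:Z = n%:Z + 1 by lia.
apply/seteqP; split=> z /=.
  move=> Az; split; last by rewrite -nS; exact: Alt_end.
  by case: Az => Az /gapS[]; split.
move=> [Az zn]; have zn0 := Alt_end Az; case: Az => Az g; split=> //; apply/gapS; split=> //.
rewrite /survives nS zn addrK zn0 /alt /=.
by case: r; case: (odd n).
Qed.

(** Two further alternations use each off-diagonal entry once, in one order or the other. *)
Let pr_AltSS n : pr nu [set z | Alt n.+2 z] = pr nu [set z | Alt n z] * a.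
Proof. rewrite !pr_AltS -mulrA /alt /= /a; case: r; case: (odd n) => /=; ring. Qed.

Let pr_Alt_even k : pr nu [set z | Alt k.*2 z] = pr nu [set z | A z] * a ^+ k.
Proof.
elim: k => [|k IH].
  rewrite expr0 mulr1; congr pr; apply/seteqP; split=> z /=; first by case.
  by move=> Az; split=> // i; case: i.
by rewrite doubleS pr_AltSS IH exprSr mulrA.
Qed.

(** The events [F' k], sorted by the length of the alternation after 0, are disjoint and their
    probabilities form a geometric series of ratio [a]. *)
Lemma pr_next_letter s :
  pr nu [set z | A z /\ next_letter z s] = pr nu [set z | A z] * thin_mx r s.
Proof.
(* A survivor repeats the letter before it, so the alternation must stop on the letter [s]. This
   fixes its parity: even length if [s = r], odd otherwise. *)
pose idx k := (k.*2 + (s != r))%N.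
have alt_idx k : alt (idx k) = s.
  by rewrite /alt /idx oddD odd_double /= oddb; clear; case: r; case: s.
pose F' k := [set z | Alt (idx k) z /\ z ((idx k)%:Z + 1) = s].
have mF k : measurable (F' k).
  apply: measurable_and; first exact: local_measurable (@lAlt _).
  exact: measurable_letter.
have nS n : n%:Z + 1 = n.+1%:Z by lia.
have F'E k z : F' k z -> [/\ A z, gap z (idx k), survives z (idx k).+1%:Z & z (idx k).+1%:Z = s].
  rewrite /F' /= nS => -[Az zs]; case: (Az) => ? ?; split => //.
  by rewrite /survives zs -nS addrK (Alt_end Az) alt_idx.
have dF m n z : F' m z -> F' n z -> m = n.
  move=> /F'E [_ g1 s1 _] /F'E [_ g2 s2 _].
  by have := gap_unique g1 s1 g2 s2; rewrite /idx; lia.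
have UF : \bigcup_k F' k = [set z | A z /\ next_letter z s].
  apply/seteqP; split=> z.
    by move=> [k _ /F'E [Az g sn zs]]; split=> //; exists (idx k).
  move=> [Az [n [g sn zs]]].
  have altn : alt n = s.
    rewrite -zs -(Alt_end (conj Az g)); move: sn; rewrite /survives -nS addrK.
    by move/eqP.
  have nE : n = idx n./2.
    rewrite /idx -{1}(odd_double_half n) addnC; congr (_ + _)%N.
    by move: altn; rewrite /alt => <-; case: r; case: (odd n).
  by exists n./2 => //; rewrite /F' /= -nE nS.
have := @pr_series_cvg _ _ _ nu F' mF dF; rewrite UF => cv1.
pose w := if r == s then p r r else p r s * p s s.
have pF k : pr nu (F' k) = geometric (pr nu [set z | A z] * w) a k.
  rewrite /F' (pr_markov mk s (@lAlt _) (@Alt_end _)) alt_idx /geometric /= /w /idx.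
  case: (eqVneq r s) => [->|nrs]; rewrite ?eqxx /=.
    by rewrite addn0 pr_Alt_even; ring.
  rewrite addn1 pr_AltS pr_Alt_even /alt /= odd_double /= addbF addbT.
  have -> : ~~ r = s by move: nrs; clear; case: r; case: s.
  ring.
have : series (fun n => pr nu (F' n)) @ \oo --> pr nu [set z | A z] * w / (1 - a).
  rewrite (_ : series _ = series (geometric (pr nu [set z | A z] * w) a)).
    apply: cvg_geometric_series; case/andP: a01 => a0 a1.
    by rewrite ger0_norm.
  by congr series; apply/funext => k.
move=> cv2; rewrite (cvg_uniqueR cv1 cv2).
by rewrite /thin_mx -/a -/w mulrA.
Qed.

End NextSurvivor.

Let shift_set m A := @pr_shift R nu st m A.

Let mnext s : measurable [set z | next_letter z s].
Proof.
apply: (@measurable_pred_eq _ _ _ (fun z : config => exists n : nat, gap z n /\ (survives z n.+1%:Z /\ z n.+1%:Z = s))).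
  by move=> z; split=> -[n]; [case=> ? ? ?|case=> ? [? ?]]; exists n.
apply: measurable_exists => n; apply: measurable_and; first exact: local_measurable (@local_gap n).
by apply: measurable_and; [exact: measurable_survives|exact: measurable_letter].
Qed.

(** Given the letter at 0, the two possible next letters have total probability 1 by [thin_mx_sum],
    so no mass is left for an infinite gap. *)
Lemma pr_exists_next : pr nu [set z | exists2 x, 0 < x & survives z x] = 1.
Proof.
have mB : measurable [set z | exists2 x, 0 < x & survives z x].
  apply: (@measurable_pred_eq _ _ _ (fun z : config => exists x, 0 < x /\ survives z x)).
    by move=> z; split=> -[x]; [exists x | case=> ? ?; exists x].
  by apply: measurable_exists => x; apply: measurable_conj; exact: measurable_survives.
have H r : pr nu [set z | z 0 = r] <=
    pr nu ([set z | exists2 x, 0 < x & survives z x] `&` [set z | z 0 = r]).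
  rewrite -[leLHS]mulr1 -(thin_mx_sum r) mulrDr.
  rewrite -!(@pr_next_letter 0 (fun z => z 0 = r)) //; try exact: local_letter.
  have mN s : measurable [set z : config | z 0 = r /\ next_letter z s].
    by apply: measurable_and => //; exact: measurable_letter.
  have mBr : measurable ([set z | exists2 x, 0 < x & survives z x] `&` [set z | z 0 = r]).
    by apply: measurableI => //; exact: measurable_letter.
  rewrite [leRHS](pr_setID nu mBr (mnext true)); apply: lerD.
    apply: pr_le => //; first exact: measurableI.
    move=> z [z0 nl]; split=> //; split=> //.
    by case: nl => n [_ sn _]; exists n.+1%:Z.
  apply: pr_le => //; first by apply: measurableI => //; exact: measurableC.
  move=> z [z0 nl]; split; first by split=> //; case: nl => n [_ sn _]; exists n.+1%:Z.
  by move=> /thin_next_letter; rewrite (thin_next_letter nl).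
apply/eqP; rewrite eq_le -{1}(pr_setT nu) pr_le //=.
rewrite -{1}(pr_setT nu) (pr_setID nu measurableT (measurable_letter 0 true)).
rewrite (pr_setID nu mB (measurable_letter 0 true)).
have -> : ~` [set z : config | z 0 = true] = [set z | z 0 = false].
  by apply/seteqP; split=> z /=; case: (z 0).
by rewrite !setTI lerD.
Qed.

Lemma pr_forall (I : countType) (P : I -> config -> Prop) :
  (forall i, measurable [set z | P i z]) -> (forall i, pr nu [set z | P i z] = 1) ->
  pr nu [set z | forall i, P i z] = 1.
Proof.
move=> mP hP; pose C i := ~` [set z | P i z].
(* An enumeration of [I]; numbers that code no element contribute the empty set. *)
pose D n := if unpickle n is Some i then C i else set0.
have mD n : measurable (D n).
  by rewrite /D; case: unpickle => // i; exact: measurableC.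
have nD : nu (\bigcup_n D n) = 0.
  apply: measure_negligible; first exact: bigcup_measurable.
  apply: negligible_bigcup => n; apply/negligibleP => //.
  rewrite /D; case: unpickle => [i|]; last exact: measure0.
  have e : nu (C i) = 0%E.
    rewrite prE; last exact: measurableC.
    by congr EFin; have := pr_setID nu measurableT (mP i); rewrite !setTI pr_setT hP /C; lra.
  exact: e.
have -> : [set z | forall i, P i z] = ~` \bigcup_n D n.
  apply/seteqP; split=> z /=.
    by move=> h [n _]; rewrite /D; case: unpickle => // i; apply.
  move=> h i; apply: contrapT => nP; apply: h; exists (pickle i) => //.
  by rewrite /D pickleK.
by rewrite /pr probability_setC ?nD ?sube0 //; exact: bigcup_measurable.
Qed.

Lemma pr_unbounded_survives : pr nu [set z | unbounded_both (survives z)] = 1.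
Proof.
pose up (m : int) := [set z : config | exists2 x, m < x & survives z x].
pose dn (m : int) := [set z : config | exists2 x, x < m & survives z x].
have mup m : measurable (up m).
  apply: (@measurable_pred_eq _ _ _ (fun z : config => exists x, m < x /\ survives z x)).
    by move=> z; split=> -[x]; [exists x | case=> ? ?; exists x].
  by apply: measurable_exists => x; apply: measurable_conj; exact: measurable_survives.
have mdn m : measurable (dn m).
  apply: (@measurable_pred_eq _ _ _ (fun z : config => exists x, x < m /\ survives z x)).
    by move=> z; split=> -[x]; [exists x | case=> ? ?; exists x].
  by apply: measurable_exists => x; apply: measurable_conj; exact: measurable_survives.
have pup m : pr nu (up m) = 1.
  rewrite -pr_exists_next -(shift_set m (mup 0)); congr pr.
  apply/seteqP; split=> z /= -[x mx sx].
    by exists (x - m); [lia | rewrite survives_shift subrK].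
  by exists (x + m); [lia | rewrite -survives_shift].
(* By stationarity a long gap to the left is as unlikely as one to the right. *)
have pdn m : pr nu (dn m) = 1.
  pose N n := [set z : config | forall i : nat, (i < n)%N -> ~~ survives z (m - n%:Z + i%:Z)].
  pose N' n := [set z : config | forall i : nat, (i < n)%N -> ~~ survives z (1 + i%:Z)].
  have mns x : measurable [set z : config | ~~ survives z x].
    rewrite (_ : [set z | _] = ~` [set z | survives z x]); first by apply: measurableC; exact: measurable_survives.
    by apply/seteqP; split=> z /= /negP.
  have mN n : measurable (N n).
    by apply: measurable_forall => i; apply: measurable_imp.
  have mN' n : measurable (N' n).
    by apply: measurable_forall => i; apply: measurable_imp.
  have NN n : pr nu (N n) = pr nu (N' n).
    rewrite -(shift_set (m - n%:Z - 1) (mN' n)); congr pr.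
    apply/funext => z; apply: eq_forall => i; congr (_ -> is_true (~~ _)).
    by rewrite survives_shift; congr survives; lia.
  have c1 : pr nu (N n) @[n --> \oo] --> pr nu (\bigcap_n N n).
    apply: pr_bigcap_cvg => // k n kn z /= h i ik.
    have := h (i + (n - k))%N; rewrite (_ : m - n%:Z + (i + (n - k))%N%:Z = m - k%:Z + i%:Z); last by lia.
    by apply; lia.
  have c2 : pr nu (N' n) @[n --> \oo] --> pr nu (\bigcap_n N' n).
    by apply: pr_bigcap_cvg => // k n kn z /= h i ik; apply: h; lia.
  have n1 : \bigcap_n N n = ~` dn m.
    apply/seteqP; split=> z /=.
      move=> h [x xm sx]; have {}h := h `|m - x|%N I 0%N ltac:(lia).
      have e : m - `|m - x|%N%:Z + 0%N%:Z = x by lia.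
      by rewrite e sx in h.
    move=> h n _ i ni; apply/negP => s; apply: h; exists (m - n%:Z + i%:Z) => //; lia.
  have n2 : \bigcap_n N' n = ~` up 0.
    apply/seteqP; split=> z /=.
      move=> h [x xm sx]; have {}h := h `|x|%N I `|x|.-1 ltac:(lia).
      have e : 1 + `|x|.-1%:Z = x by lia.
      by rewrite e sx in h.
    move=> h n _ i ni; apply/negP => s; apply: h; exists (1 + i%:Z) => //; lia.
  rewrite (_ : (fun n => pr nu (N n)) = fun n => pr nu (N' n)) in c1; last by apply/funext.
  have := cvg_uniqueR c1 c2; rewrite n1 n2.
  have := pr_setID nu measurableT (mdn m); have := pr_setID nu measurableT (mup 0).
  rewrite !setTI pr_setT pup; lra.
have mU1 := @measurable_forall _ _ _ up mup.
have mU2 := @measurable_forall _ _ _ dn mdn.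
have /= h1 := @pr_forall _ (fun m z => up m z) mup pup.
have /= h2 := @pr_forall _ (fun m z => dn m z) mdn pdn.
by rewrite -h1 (pr0_ae mU1 mU2 h2).
Qed.

End ThinnedChain.

(** * The Palm law of the survivors *)

HB.instance Definition _ :=
  isMeasurableFun.Build _ _ config config thin measurable_thin.

(** Moving the origin to a site of rank 1 lowers every rank by one. *)
Lemma thin_shift z m : rank z m = 1 -> thin (shift m z) = shift 1 (thin z).
Proof.
move=> rm; apply/funext => x; rewrite [RHS]/shift /thin; apply: asbool_equiv_eq.
split=> -[y [sy ry zy]].
  by exists (y + m); rewrite -survives_shift; split=> //; move: ry; rewrite rank_shift rm => <-; rewrite subrK.
exists (y - m); rewrite survives_shift rank_shift /shift !subrK ry rm addrK.
by split.
Qed.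

(** The rank condition forces the survivors of ranks [-n] to 0 to lie right of [-N], so finitely
    many letters determine this piece of the thinned past. *)
Lemma local_thin (N n : nat) v : local (- N%:Z - 1) 0 (fun z => rank z (- N%:Z) <= - n.+1%:Z /\
  forall i : nat, (i <= n)%N -> thin z (- i%:Z) = v (- i%:Z)).
Proof.
move=> z z' e.
have es x : - N%:Z <= x <= 0 -> survives z' x = survives z x.
  by move=> hx; rewrite /survives !e //; lia.
have er x : - N%:Z <= x <= 0 -> rank z' x = rank z x.
  move=> /andP[hN]; move: x hN => x hN x0; move: x x0 hN.
  apply: int_ind_le => [|x x0 IH hN]; first by rewrite !rank0.
  have := rank_step z x; have := rank_step z' x; rewrite es; last by lia.
  by rewrite IH; lia.
move=> [rN h]; split; first by rewrite er //; lia.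
move=> i ni; rewrite -h //.
have [||y [hy y0 ry /rank_jump jy]] := @lazy_walk_between _ (- N%:Z) 0 (- i%:Z) (@rank_lazy z).
- by lia.
- by rewrite rank0; lia.
rewrite -ry thin_rank // -{1}er; last by lia.
by rewrite thin_rank ?es ?e //; lia.
Qed.

Section ThinLaw.
Context {R : realType}.
Variables (nu : probability config R) (p : bool -> bool -> R).
Hypotheses (st : stationary nu) (mk : markov_chain p nu).
Hypotheses (p1 : forall r, p r true + p r false = 1).
Hypotheses (a01 : 0 <= p false true * p true false < 1).

Let B := [set z : config | survives z 0].
Let mB : measurable B := measurable_survives 0.
Hypothesis B0 : 0 < pr nu B.

(* The Palm law of the surviving sites, enumerated by [thin]. *)
Definition thin_law : probability config R :=
  distribution (mnormalize (mrestr nu mB) nu) thin.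

Let thin_preimage A : measurable A -> measurable [set z | A (thin z)].
Proof. by move=> mA; have := measurable_thin measurableT mA; rewrite setTI. Qed.

Lemma pr_thin_law A : measurable A ->
  pr thin_law A = pr nu [set z | survives z 0 /\ A (thin z)] / pr nu B.
Proof.
move=> mA; rewrite /pr /thin_law /= /distribution /pushforward /= /mnormalize /=.
have e : mrestr nu mB setT = (pr nu B)%:E by rewrite /mrestr setTI prE.
rewrite e eqe gt_eqF //= /mrestr fineM ?fin_num_measure //; last first.
  by apply: measurableI => //; exact: thin_preimage.
by congr (fine (nu _) * _); apply/seteqP; split=> z [].
Qed.

Let U := [set z : config | unbounded_both (survives z)].
Let mU : measurable U.
Proof. by apply: measurable_unbounded => x; exact: measurable_survives. Qed.
Let U1 : pr nu U = 1.
Proof. exact: pr_unbounded_survives st mk p1 a01. Qed.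

Let mgap n : measurable [set z | gap z n] := local_measurable (@local_gap n).

(** Stationarity under moving the origin to the next survivor. [F n] has that survivor at [n + 1],
    [G n] has the previous one at [-(n + 1)]; a shift by [n + 1] matches them, and both families are
    almost surely exhaustive. *)
Lemma pr_thin_shift A : measurable A ->
  pr nu [set z | survives z 0 /\ A (shift 1 (thin z))] =
  pr nu [set z | survives z 0 /\ A (thin z)].
Proof.
move=> mA; have mAt := thin_preimage mA.
have mAs := thin_preimage (measurable_shift_preimage 1 mA).
pose F n := [set z : config | (survives z 0 /\ A (shift 1 (thin z))) /\ (gap z n /\ survives z n.+1%:Z)].
pose G n := [set z : config | (survives z 0 /\ A (thin z)) /\
  (survives z (- n.+1%:Z) /\ forall i : nat, (0 < i <= n)%N -> ~~ survives z (- i%:Z))].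
have mF n : measurable (F n).
  apply: measurable_and; first by apply: measurable_and => //; exact: measurable_survives.
  by apply: measurable_and => //; exact: measurable_survives.
have mG n : measurable (G n).
  apply: measurable_and; first by apply: measurable_and => //; exact: measurable_survives.
  apply: measurable_and; first exact: measurable_survives.
  apply: measurable_forall => i; apply: measurable_imp.
  rewrite (_ : [set z | _] = ~` [set z : config | survives z (- i%:Z)]).
    by apply: measurableC; exact: measurable_survives.
  by apply/seteqP; split=> z /= /negP.
have FG n : pr nu (F n) = pr nu (G n).
  rewrite -(pr_shift st n.+1%:Z (mG n)); congr pr; apply/seteqP; split=> z.
    move=> [[s0 At] [g sn]]; rewrite /G /= !survives_shift add0r addNr.
    rewrite thin_shift ?(gap_survivor_rank g sn) //; split=> //; split=> // i ni.
    rewrite survives_shift (_ : - i%:Z + n.+1%:Z = (n.+1 - i)%N%:Z); last by lia.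
    by apply: g; lia.
  rewrite /G /= !survives_shift add0r addNr => -[[sn At] [s0 g]].
  have gn : gap z n.
    move=> i ni; have := g (n.+1 - i)%N; rewrite survives_shift.
    by rewrite (_ : - (n.+1 - i)%N%:Z + n.+1%:Z = i%:Z); [apply|]; lia.
  by rewrite thin_shift ?(gap_survivor_rank gn sn) // in At.
have dF m n z : F m z -> F n z -> m = n.
  by move=> [_ [g s]] [_ [g' s']]; exact: (gap_unique g s g' s').
have dG m n z : G m z -> G n z -> m = n.
  move=> [_ [s g]] [_ [s' g']]; case: (ltngtP m n) => // h.
    by have := g' m.+1; rewrite s => /(_ h).
  by have := g n.+1; rewrite s' => /(_ h).
have c1 := @pr_series_cvg _ _ _ nu F mF dF.
have c2 := @pr_series_cvg _ _ _ nu G mG dG.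
rewrite (_ : (fun n => pr nu (F n)) = fun n => pr nu (G n)) in c1; last exact/funext.
have UFG := cvg_uniqueR c1 c2.
have mX : measurable [set z | survives z 0 /\ A (shift 1 (thin z))].
  by apply: measurable_and => //; exact: measurable_survives.
have mY : measurable [set z | survives z 0 /\ A (thin z)].
  by apply: measurable_and => //; exact: measurable_survives.
have mUF : measurable (\bigcup_n F n) by exact: bigcup_measurable.
have mUG : measurable (\bigcup_n G n) by exact: bigcup_measurable.
rewrite (pr0_ae mX mU U1) (pr0_ae mY mU U1).
transitivity (pr nu ((\bigcup_n F n) `&` U)).
  congr pr; apply/seteqP; split=> z [h Uz]; split=> //.
    have [x x0 sx] := Uz.1 0; have [n [g s]] := next_survivor x0 sx.
    by exists n.
  by case: h => n _ [].
rewrite -(pr0_ae mUF mU U1) UFG (pr0_ae mUG mU U1).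
congr pr; apply/seteqP; split=> z [h Uz]; split=> //; first by case: h => n _ [].
have [x x0 sx] := Uz.2 0; have ex : exists n : nat, survives z (- n.+1%:Z).
  by exists `|x|.-1; rewrite (_ : - _.+1%:Z = x) //; lia.
case: (ex_minnP ex) => n sn nmin; exists n => //; split=> //; split=> // i /andP[i0 ni].
by apply/negP => si; have := nmin i.-1; rewrite prednK // => /(_ si); lia.
Qed.

Lemma thin_law_stationary : stationary thin_law.
Proof.
move=> A mA; have mA1 := measurable_shift_preimage 1 mA.
rewrite [LHS](prE thin_law mA1) (prE thin_law mA) !pr_thin_law //.
by rewrite pr_thin_shift.
Qed.

Let past n (v : int -> bool) := [set z : config |
  forall i : nat, (i <= n)%N -> z (- i%:Z) = v (- i%:Z)].

Let mpast n v : measurable (past n v).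
Proof.
by apply: measurable_forall => i; apply: measurable_imp; exact: measurable_letter.
Qed.

(** The thinned past may reach arbitrarily far back. Its truncations [A N] are local, so
    [pr_next_letter] applies to each, and they increase almost surely to the full event. *)
Lemma pr_thin_markov n v s :
  pr nu [set z | survives z 0 /\ (past n v (thin z) /\ thin z 1 = s)] =
  pr nu [set z | survives z 0 /\ past n v (thin z)] * thin_mx p (v 0) s.
Proof.
pose Q z := survives z 0 /\ past n v (thin z).
pose A (N : nat) z := survives z 0 /\ (rank z (- N%:Z) <= - n.+1%:Z /\ past n v (thin z)).
have lA N : local (- N%:Z - 1) 0 (A N).
  apply: local_and; last exact: local_thin.
  by move=> z z' e; rewrite /survives !e //; lia.
have A0 N z : A N z -> z 0 = v 0.
  by move=> [s0 [_ /(_ 0%N isT) <-]]; rewrite oppr0 -{2}(rank0 z) thin_rank.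
have mA N := local_measurable (lA N).
have mS : measurable [set z | next_letter z s].
  apply: (@measurable_pred_eq _ _ _ (fun z : config => exists n : nat, gap z n /\ (survives z n.+1%:Z /\ z n.+1%:Z = s))).
    by move=> z; split=> -[k]; [case=> ? ? ?|case=> ? [? ?]]; exists k.
  apply: measurable_exists => k; apply: measurable_and => //.
  by apply: measurable_and; [exact: measurable_survives|exact: measurable_letter].
have mAS N : measurable [set z | A N z /\ next_letter z s] by exact: measurable_and.
have Amono M N z : (M <= N)%N -> A M z -> A N z.
  move=> MN [s0 [rM h]]; split=> //; split=> //; apply: le_trans rM.
  by apply: (lazy_walk_homo (@rank_lazy z)); lia.
have c1 : pr nu [set z | A N z] @[N --> \oo] --> pr nu (\bigcup_N [set z | A N z]).
  by apply: pr_bigcup_cvg => // M N MN z; exact: Amono.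
have c2 : pr nu [set z | A N z /\ next_letter z s] @[N --> \oo] -->
    pr nu (\bigcup_N [set z | A N z /\ next_letter z s]).
  by apply: pr_bigcup_cvg => // M N MN z [/(Amono _ _ _ MN) ? ?]; split.
rewrite (_ : (fun N => pr nu [set z | A N z /\ next_letter z s]) =
    fun N => pr nu [set z | A N z] * thin_mx p (v 0) s) in c2; last first.
  by apply/funext => N; apply: (pr_next_letter mk a01 _ (lA N) (@A0 N)); lia.
have c3 : pr nu [set z | A N z] * thin_mx p (v 0) s @[N --> \oo] -->
    pr nu (\bigcup_N [set z | A N z]) * thin_mx p (v 0) s.
  by apply: cvgM c1 _; exact: cvg_cst.
have mQt : measurable [set z | past n v (thin z)] := thin_preimage (mpast n v).
have m1t : measurable [set z : config | thin z 1 = s].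
  exact: (thin_preimage (measurable_letter 1 s)).
have mQ : measurable [set z | Q z] by apply: measurable_and => //; exact: measurable_survives.
have mL : measurable [set z | survives z 0 /\ (past n v (thin z) /\ thin z 1 = s)].
  by apply: measurable_and; [exact: measurable_survives|exact: measurable_and].
have mU1 : measurable (\bigcup_N [set z | A N z]) by exact: bigcup_measurable.
have mU2 : measurable (\bigcup_N [set z | A N z /\ next_letter z s]) by exact: bigcup_measurable.
have UA z : U z -> Q z -> exists N, A N z.
  move=> Uz [s0 h]; have [y ry _] := rank_onto Uz (- n.+1%:Z).
  have y0 : y < 0 by case: (leP 0 y) => // /(lazy_walk_homo (@rank_lazy z)); rewrite rank0; lia.
  by exists `|y|%N; split=> //; split=> //; rewrite (_ : - _ = y) ?ry //; lia.
have e1 : pr nu (\bigcup_N [set z | A N z]) = pr nu [set z | Q z].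
  rewrite (pr0_ae mU1 mU U1) (pr0_ae mQ mU U1); congr pr; apply/seteqP; split=> z [h Uz]; split=> //.
    by case: h => N _ [s0 [_ ?]].
  by have [N AN] := UA z Uz h; exists N.
have e2 : pr nu (\bigcup_N [set z | A N z /\ next_letter z s]) =
    pr nu [set z | survives z 0 /\ (past n v (thin z) /\ thin z 1 = s)].
  rewrite (pr0_ae mU2 mU U1) (pr0_ae mL mU U1); congr pr; apply/seteqP; split=> z [h Uz]; split=> //.
    by case: h => N _ [[s0 [_ ?]] /thin_next_letter].
  case: h => s0 [h t1]; have [N AN] := UA z Uz (conj s0 h); exists N => //; split=> //.
  have [x x0 sx] := Uz.1 0; have [k [g sk]] := next_survivor x0 sx.
  by exists k; split=> //; rewrite -t1 -(gap_survivor_rank g sk) thin_rank.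
by rewrite -e2 -e1; exact: (cvg_uniqueR c2 c3).
Qed.

(** Stationarity of the Palm law brings the present to 0, with [v'] the translated word. *)
Lemma thin_law_markov : markov_chain (thin_mx p) thin_law.
Proof.
move=> x n v s; cbv zeta; pose v' y := v (y + x).
pose Q := past n v' `&` [set z | z 1 = s].
have mQ : measurable Q by apply: measurableI; [exact: mpast | exact: measurable_letter].
have pastE (z : config) : (forall i : nat, (i <= n)%N -> z (x - i%:Z) = v (x - i%:Z)) <->
    past n v' (shift x z).
  by split=> h i /h; rewrite /shift /v' addrC.
have e1 : [set z : config | forall i : nat, (i <= n)%N -> z (x - i%:Z) = v (x - i%:Z)] =
    [set z | past n v' (shift x z)].
  by apply/funext => z; apply/propext; exact: pastE.
have e2 : [set z : config | forall i : nat, (i <= n)%N -> z (x - i%:Z) = v (x - i%:Z)] `&`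
    [set z | z (x + 1) = s] = [set z | Q (shift x z)].
  rewrite e1; apply/funext => z; apply/propext; rewrite /Q /shift /= [1 + x]addrC.
  by split.
have m1 := measurable_shift_preimage x (mpast n v').
have m2 := measurable_shift_preimage x mQ.
rewrite e2 e1 (prE thin_law m1) [LHS](prE thin_law m2) -EFinM.
rewrite !(pr_shift thin_law_stationary) //.
rewrite !pr_thin_law //.
have := pr_thin_markov n v' s; rewrite {3}/v' add0r => h.
by rewrite [X in X / _]h mulrAC.
Qed.

End ThinLaw.

(** * Transition matrices *)

(** The range in which [P(a, b)] is defined; it is stable under the parameter recursion. *)
Definition admissible {R : realType} (a b : R) : Prop :=
  [/\ 0 <= a, 0 <= b & Num.sqrt a + Num.sqrt b < 1].

Definition discr {R : realType} (a b : R) : R := (1 - (a + b)) ^+ 2 - 4 * a * b.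

Section TransitionMatrices.
Context {R : realType}.
Implicit Types a b : R.

Lemma admissible_lt1 a b : admissible a b -> a < 1 /\ b < 1.
Proof.
move=> [a0 b0 ab]; rewrite -(sqr_sqrtr a0) -(sqr_sqrtr b0).
have := sqrtr_ge0 a; have := sqrtr_ge0 b.
by split; nra.
Qed.

Lemma discr_gt0 a b : admissible a b -> 0 < discr a b.
Proof.
move=> [a0 b0 ab]; rewrite /discr -{1 2}(sqr_sqrtr a0) -{1 2}(sqr_sqrtr b0).
have := sqrtr_ge0 a; have := sqrtr_ge0 b; move: ab.
move: (Num.sqrt a) (Num.sqrt b) => s t st t0 s0.
(* Both factors are positive because [|s - t| <= s + t < 1]. *)
have -> : (1 - (s ^+ 2 + t ^+ 2)) ^+ 2 - 4 * s ^+ 2 * t ^+ 2 =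
  (1 - (s + t) ^+ 2) * (1 - (s - t) ^+ 2) by ring.
by apply: mulr_gt0; nra.
Qed.

Lemma trans_mx_sum a b r : trans_mx a b r true + trans_mx a b r false = 1.
Proof. by case: r; rewrite /trans_mx; field. Qed.

(** The entries are conjugate in [D], so their product is rational in [a] and [b]. It shows that the
    parameter [a] is the ratio of the geometric series above. *)
Lemma trans_mx_updown a b : admissible a b ->
  trans_mx a b false true * trans_mx a b true false = a.
Proof.
move=> /discr_gt0 /ltW /sqr_sqrtr; rewrite /trans_mx -/(discr a b).
move: (Num.sqrt _) => D; rewrite /discr => h.
have -> : (1 + a - b - D) / 2 * ((1 + a - b + D) / 2) = ((1 + a - b) ^+ 2 - D ^+ 2) / 4 by field.
by rewrite h; field.
Qed.

Definition next_ab a b : R * R := (a * b / (1 - a) ^+ 2, b / (1 - a) ^+ 2).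

(** With [s] and [t] the old square roots, the new ones add up to
    [t (1 + s) / (1 - s^2) = t / (1 - s)]. *)
Lemma admissible_next a b : admissible a b ->
  admissible (next_ab a b).1 (next_ab a b).2.
Proof.
move=> adm; have [a1 b1] := admissible_lt1 adm; case: adm => a0 b0 ab.
have a1' : 0 < 1 - a by rewrite subr_gt0.
rewrite /next_ab /=; split.
- by apply: divr_ge0; [exact: mulr_ge0 | exact: sqr_ge0].
- by apply: divr_ge0 => //; exact: sqr_ge0.
have sqV : Num.sqrt (((1 - a) ^+ 2)^-1) = (1 - a)^-1.
  by rewrite -exprVn sqrtr_sqr ger0_norm // invr_ge0 ltW.
rewrite sqrtrM ?mulr_ge0 // (sqrtrM _ a0) (sqrtrM _ b0) sqV -mulrDl ltr_pdivrMr // mul1r.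
have := sqrtr_ge0 a; have := sqrtr_ge0 b; move: ab (sqr_sqrtr a0).
move: (Num.sqrt a) (Num.sqrt b) => s t st <- t0 s0.
have -> : s * t + t = t * (1 + s) by ring.
by nra.
Qed.

Lemma discr_next a b : a < 1 ->
  discr (next_ab a b).1 (next_ab a b).2 = discr a b / (1 - a) ^+ 2.
Proof. by move=> a1; rewrite /discr /next_ab /=; field; rewrite subr_eq0 gt_eqF. Qed.

(** The root [D] scales by [1 / (1 - a)], which settles the diagonal; the remaining entries follow
    since all rows sum to 1. *)
Lemma thin_trans_mx a b : admissible a b ->
  thin_mx (trans_mx a b) = trans_mx (next_ab a b).1 (next_ab a b).2.
Proof.
move=> adm; have [a1 _] := admissible_lt1 adm.
have a1' : 1 - a != 0 by rewrite subr_eq0 gt_eqF.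
have diag r : thin_mx (trans_mx a b) r r = trans_mx (next_ab a b).1 (next_ab a b).2 r r.
  rewrite /thin_mx eqxx (trans_mx_updown adm) /trans_mx -!/(discr _ _) discr_next //.
  rewrite sqrtrM ?ltW ?discr_gt0 // -exprVn sqrtr_sqr ger0_norm; last first.
    by rewrite invr_ge0 subr_ge0 ltW.
  by case: r; rewrite /next_ab /=; field.
have a01 : 0 <= trans_mx a b false true * trans_mx a b true false < 1.
  by rewrite (trans_mx_updown adm) a1 andbT; case: adm.
have sum1 := thin_mx_sum (@trans_mx_sum a b) a01.
have sum2 := trans_mx_sum (next_ab a b).1 (next_ab a b).2.
apply/funext => r; apply/funext => s.
case: r s => -[]; rewrite ?diag //.
  by have := sum1 true; rewrite -(sum2 true) diag => /addrI.
by have := sum1 false; rewrite -(sum2 false) diag => /addIr.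
Qed.

(** The balance equation gives [q = (1 - D / (1 + a - b)) / 2], below one half because [D > 0]. The
    eigenvalue [b - a] has modulus below 1. *)
Lemma chain_Omega_as (nu : probability config R) a b : admissible a b ->
  stationary nu -> markov_chain (trans_mx a b) nu -> pr nu (Omega R) = 1.
Proof.
move=> adm st mk; have [a1 b1] := admissible_lt1 adm; have [a0 b0 _] := adm.
pose q := pr nu [set z | z 0 = true].
have q01 := stationary_q01 (erefl q).
have eq_q : q = q * trans_mx a b true true + (1 - q) * trans_mx a b false true.
  have q0' : pr nu [set z | z 0 = false] = 1 - q.
    have := pr_setID nu measurableT (measurable_letter 0 true).
    rewrite !setTI pr_setT -/q (_ : ~` _ = [set z : config | z 0 = false]); first by lra.
    by apply/seteqP; split=> z /=; case: (z 0).
  have M r : pr nu [set z | z 0 = r /\ z (0 + 1) = true] =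
      pr nu [set z | z 0 = r] * trans_mx a b r true.
    exact: (pr_markov mk true (@local_letter 0 r)).
  rewrite -q0' {2}/q -!M /q -(pr_shift st 1 (measurable_letter 0 true)).
  rewrite (pr_setID nu (A := [set z | shift 1 z 0 = true]) _ (measurable_letter 0 true)); last exact: (measurable_letter (0 + 1) true).
  congr (_ + _); congr pr; apply/seteqP; split=> z /=; rewrite /shift; case: (z 0) => -[] //.
have D0 : 0 < Num.sqrt (discr a b) by rewrite sqrtr_gt0 discr_gt0.
apply: (@density_lt_half_as _ q q01).
  move: eq_q; rewrite /trans_mx -/(discr a b); move: (Num.sqrt _) D0 => D D0 e.
  by nra.
apply: (@deviation_bound _ nu _ st mk q (b - a)) => //.
- exact: trans_mx_sum.
- move=> r; move: eq_q; rewrite /trans_mx; case: r => /=; move: (Num.sqrt _) => D e; lra.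
- by rewrite ltr_norml; apply/andP; split; lra.
Qed.

Lemma conditioned_chain_thin d (T : measurableType d) (Pr : probability T R)
    (X : T -> config) a b : admissible a b ->
  conditioned_chain Pr X (trans_mx a b) (Omega_r R) ->
  conditioned_chain Pr (fun w => thin (X w))
    (trans_mx (next_ab a b).1 (next_ab a b).2) (Omega_r R).
Proof.
move=> adm [mX [nu [st mk E0 law]]]; split.
  exact: (measurableT_comp measurable_thin mX).
have [a1 _] := admissible_lt1 adm.
have a01 : 0 <= trans_mx a b false true * trans_mx a b true false < 1.
  by rewrite (trans_mx_updown adm) a1 andbT; case: adm.
have p1 := @trans_mx_sum a b.
have mE := measurable_Omega_r R.
have mO := measurable_Omega R.
have mOR := measurable_origin_records.
have mB := measurable_survives 0.
have E0' : 0 < pr nu (Omega_r R) by rewrite -lte_fin -prE.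
have EB : Omega_r R `<=` [set z | survives z 0].
  by move=> z; rewrite Omega_rE => -[_ [_ /record_survives]].
have B0 : 0 < pr nu [set z | survives z 0].
  by apply: lt_le_trans E0' _; apply: pr_le.
pose nu' := thin_law nu.
have st' : stationary nu' := thin_law_stationary st mk p1 a01 B0.
have mk' : markov_chain (thin_mx (trans_mx a b)) nu' := thin_law_markov st mk p1 a01 B0.
rewrite (thin_trans_mx adm) in mk'.
have O1 := chain_Omega_as adm st mk.
have O1' : pr nu' (Omega R) = 1 by apply: chain_Omega_as st' mk'; exact: admissible_next.
have U1 := pr_unbounded_survives st mk p1 a01.
have mU : measurable [set z | unbounded_both (survives z)].
  by apply: measurable_unbounded => x; exact: measurable_survives.
have mthin A : measurable A -> measurable [set z | A (thin z)].
  by move=> mA; have := measurable_thin measurableT mA; rewrite setTI.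
(* The density condition is almost sure under both [nu] and [nu'], so only [origin_records] matters,
   and that event is carried over by [origin_records_thin]. *)
have key A : measurable A -> pr nu' (A `&` Omega_r R) =
    pr nu ([set z | A (thin z)] `&` Omega_r R) / pr nu [set z | survives z 0].
  move=> mA; have mAt := mthin A mA.
  have mAOR : measurable (A `&` [set z | origin_records z]) by exact: measurableI.
  have mAO : measurable ([set z | A (thin z)] `&` [set z | origin_records z]).
    exact: measurableI.
  have eE (C : set config) : C `&` Omega_r R = C `&` [set z | origin_records z] `&` Omega R.
    by rewrite Omega_rE setIA setIAC.
  have -> : pr nu' (A `&` Omega_r R) = pr nu' (A `&` [set z | origin_records z]).
    by rewrite (pr0_ae mAOR mO O1') eE.
  have -> : pr nu ([set z | A (thin z)] `&` Omega_r R) =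
      pr nu ([set z | A (thin z)] `&` [set z | origin_records z]).
    by rewrite (pr0_ae mAO mO O1) eE.
  rewrite (pr_thin_law B0 mAOR); congr (_ / _).
  have mL : measurable [set z | survives z 0 /\ (A `&` [set z | origin_records z]) (thin z)].
    by apply: measurable_and => //; exact: mthin.
  rewrite (pr0_ae mL mU U1) (pr0_ae mAO mU U1); congr pr.
  apply/seteqP; split=> z.
    move=> [[s0 [Az oz]] Uz]; split=> //; split=> //.
    exact: (origin_records_thin Uz s0).1.
  move=> [[Az oz] Uz]; have s0 : survives z 0 by apply: record_survives; case: oz.
  by split=> //; split=> //; split=> //; exact: (origin_records_thin Uz s0).2.
exists nu'; split=> //.
  rewrite prE // lte_fin; have := key setT measurableT; rewrite !setTI => ->.
  exact: divr_gt0.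
(* Conditioning takes a quotient of two instances of [key], in which the survival probability of the
   origin cancels. *)
move=> A mA; rewrite [LHS](law [set z | A (thin z)]); last exact: mthin.
rewrite -!/(pr _ _) key //.
have := key setT measurableT.
rewrite !setTI => ->.
congr EFin; rewrite -mulf_div divff ?mulr1 //.
by rewrite invr_eq0 gt_eqF.
Qed.

Lemma ab_seqS a b k : (a_seq a b k.+1, b_seq a b k.+1) = next_ab (a_seq a b k) (b_seq a b k).
Proof. by rewrite /a_seq /b_seq /=; case: (ab_seq a b k). Qed.

Lemma conditioned_chain_iter_thin d (T : measurableType d) (Pr : probability T R)
    (X : T -> config) a b k : admissible a b ->
  conditioned_chain Pr X (trans_mx a b) (Omega_r R) ->
  conditioned_chain Pr (fun w => iter k thin (X w))
    (trans_mx (a_seq a b k) (b_seq a b k)) (Omega_r R).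
Proof.
move=> adm cX.
suff [] : admissible (a_seq a b k) (b_seq a b k) /\
  conditioned_chain Pr (fun w => iter k thin (X w))
    (trans_mx (a_seq a b k) (b_seq a b k)) (Omega_r R) by [].
elim: k => [|k [admk IH]]; first by split.
have [-> ->] : a_seq a b k.+1 = (next_ab (a_seq a b k) (b_seq a b k)).1 /\
    b_seq a b k.+1 = (next_ab (a_seq a b k) (b_seq a b k)).2.
  by rewrite -ab_seqS.
split; first exact: admissible_next.
exact: conditioned_chain_thin.
Qed.

End TransitionMatrices.

Theorem theorem5p16 (R : realType) (a b : R) (hab : in_P' a b)
    (d : measure_display) (T : measurableType d) (Pr : probability T R)
    (eta : T -> config)
    (heta : conditioned_chain Pr eta (trans_mx a b) (Omega_r R))
    (k : nat) (hk : (0 < k)%N) :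
  conditioned_chain Pr (fun w => Psi R k (eta w))
    (trans_mx (a_seq a b k) (b_seq a b k)) (Omega_r R).
Proof.
have adm : admissible a b.
  by case: hab => /andP[a0 _] /andP[b0 _] _ ab.
have [mX [nu [st mk E0 law]]] := conditioned_chain_iter_thin k adm heta.
have [meta [nu0 [_ _ E00 law0]]] := heta.
have mPsi : measurable_fun setT (fun w => Psi R k (eta w)).
  exact: (measurableT_comp (measurable_Psi R hk) meta).
split=> //; exists nu; split=> // A mA; rewrite -law //.
have mE := measurable_Omega_r R.
have pre (X : T -> config) (C : set config) : measurable_fun setT X -> measurable C ->
    measurable (X @^-1` C).
  by move=> mX' mC; rewrite -[X in measurable X]setTI; exact: mX'.
(* [Psi R k] agrees with the iterated removal only on [Omega_r]; since [eta] lies there almost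
   surely, the two images have the same law. *)
have as_Or : pr Pr (eta @^-1` Omega_r R) = 1.
  have E0' : 0 < pr nu0 (Omega_r R) by rewrite -lte_fin -prE.
  by rewrite /pr law0 // setIid /= divff // gt_eqF.
have m1 := pre _ _ mPsi mA; have m2 := pre _ _ mX mA; have m3 := pre _ _ meta mE.
rewrite !prE // (pr0_ae m1 m3 as_Or) (pr0_ae m2 m3 as_Or); congr (EFin (pr Pr _)).
apply/seteqP; split=> w [/= Aw ew]; split=> //=; move: Aw; rewrite /preimage /mkset PsiE // mem_set //.
Qed.
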